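(* Let $A$ be a commutative, noetherian, reduced ring with identity, $I\subset A[x]=A[x_1,\ldots,x_n]$ an ideal, and $<$ a term order. Let $Y$ be a locally closed subset of $\operatorname{Spec}(A)$ and $\mathfrak{a}\subset A$ the radical ideal such that $\overline{Y}=V(\mathfrak{a})$. Denote by $\overline{I}$ the image of $I$ in $(A/\mathfrak{a})[x]$. Then $Y$ is parametric for Gröbner bases with respect to $I$ if and only if \[Y\cap V(J(\overline{I}))=\emptyset.\] In other words: $Y$ is parametric if and only if every $\mathfrak{p}\in Y$ is lucky for $\overline{I}$.
   Context: Standing setting: $A$ is a commutative, noetherian, reduced ring with identity, $I$ is an ideal of $A[x]=A[x_1,\ldots,x_n]$, $\mathcal{T}$ is the set of terms (power products) in $x_1,\ldots,x_n$, and $<$ is a fixed term order on $\mathcal{T}$. For a nonzero polynomial $P$ over a commutative ring, $\operatorname{lt}(P)$ is the largest term occurring in $P$ with nonzero coefficient, and $\operatorname{lc}(P)$ is its coefficient. For an ideal $K$ of a polynomial ring, $\operatorname{lt}(K)=\{\operatorname{lt}(P);\ P\in K\smallsetminus\{0\}\}$. For $\mathfrak{p}\in\operatorname{Spec}(A)$, $k(\mathfrak{p})=A_\mathfrak{p}/\mathfrak{p}A_\mathfrak{p}$, $\sigma_\mathfrak{p}:A[x]\to k(\mathfrak{p})[x]$ is the coefficientwise extension of $A\to k(\mathfrak{p})$, and $\langle\sigma_\mathfrak{p}(I)\rangle$ is the ideal generated by $\sigma_\mathfrak{p}(I)$. A locally closed subset $Y$ of $\operatorname{Spec}(A)$ carries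 the induced reduced subscheme structure $\mathcal{O}_Y$. With $\mathfrak{a}$ the radical ideal such that $\overline{Y}=V(\mathfrak{a})$ and $\overline{I}$ the extension of $I$ in $(A/\mathfrak{a})[x]$, identify $\operatorname{Spec}(A/\mathfrak{a})$ with $V(\mathfrak{a})\subset\operatorname{Spec}(A)$ and define $\mathcal{I}_Y$ as the restriction to $Y$ of the quasi-coherent sheaf on $\operatorname{Spec}(A/\mathfrak{a})$ associated to the $A/\mathfrak{a}$-module $\overline{I}$. Then $\mathcal{I}_Y(Y)$ is regarded as an ideal of $\mathcal{O}_Y(Y)[x]$. For $g\in\mathcal{I}_Y(Y)$ and $\mathfrak{p}\in Y$, $\overline{g}^{\mathfrak{p}}\in\langle\sigma_\mathfrak{p}(I)\rangle$ denotes the image of $g$ under the coefficientwise map $\mathcal{O}_Y(Y)[x]\to k(\mathfrak{p})[x]$. Parametric: a locally closed $Y\subset\operatorname{Spec}(A)$ is parametric (for Gröbner bases with respect to $I$ and $<$) if there is a finite subset $G\subset\mathcal{I}_Y(Y)$ such that (1) $\overline{G}^{\mathfrak{p}}=\{\overline{g}^{\mathfrak{p}};\ g\in G\}$ is the reduced Gröbner basis of $\langle\sigma_\mathfrak{p}(I)\rangle$ for every $\mathfrak{p}\in Y$, and (2) for each $g\in G$ the function $\mathfrak{p}\mapsto\operatorname{lt}(\overline{g}^{\mathfrak{p}})$ is constant on $Y$. Lucky primes and singular ideal: let $R$ be a commutative noetherian reduced ring (here $R=A/\mathfrak{a}$) and $K\subset R[x]$ an ideal. For $t\in\mathcal{T}$,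 $\operatorname{lc}(K,t)=\{\operatorname{lc}(P);\ P\in K,\ \operatorname{lt}(P)=t\}\cup\{0\}$, an ideal of $R$. A prime $\mathfrak{p}$ of $R$ is lucky for $K$ if for every $t\in\operatorname{lt}(K)$ it does not contain $\operatorname{lc}(K,t)$. Let $T$ be the unique minimal generating set of $\operatorname{lt}(K)$, i.e. the finite set of elements of $\operatorname{lt}(K)$ minimal with respect to divisibility. The singular ideal of $K$ is $J(K)=\sqrt{\prod_{t\in T}\operatorname{lc}(K,t)}\subset R$. *)

(* Defs.v *)
From HB Require Import structures.
From mathcomp Require Import all_boot all_order all_algebra finmap ring.
From mathcomp Require Import boolp classical_sets cardinality fsbigop topology.
From mathcomp Require Import monalg.

Set Implicit Arguments.
Unset Strict Implicit.
Unset Printing Implicit Defensive.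

Import GRing.Theory.

Local Open Scope fset_scope.
Local Open Scope classical_set_scope.
Local Open Scope ring_scope.

Local Notation "1" := (@mone _) : monom_scope.
Local Notation "s * t" := (mmul s t) : monom_scope.

(* Rings are [comPzRingType]s throughout: A/a and O_Y(Y) are zero when Y is
   empty. *)

Section Ideals.
Variable R : comPzRingType.
Implicit Types (S K L : set R).

Definition is_ideal K : Prop :=
  [/\ K 0, forall x y, K x -> K y -> K (x + y) & forall r x, K x -> K (r * x)].

Record ideal := Ideal { ideal_set :> set R; idealP : is_ideal ideal_set }.

Definition ideal_span S : set R :=
  [set x | forall K, is_ideal K -> S `<=` K -> K x].

Lemma ideal_span_is_ideal S : is_ideal (ideal_span S).
Proof.
split=> [K [K0 _ _] _|x y hx hy K hK SK|r x hx K hK SK] //.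
  by case: (hK) => _ KD _; apply: KD; [apply: hx|apply: hy].
by case: (hK) => _ _ KM; apply: KM; apply: hx.
Qed.

Definition ideal_gen S : ideal := Ideal (ideal_span_is_ideal S).

Definition ideal_mul K L : set R :=
  ideal_gen [set z | exists x y, [/\ K x, L y & z = x * y]].

Definition radical S : set R := [set x | exists k : nat, S (x ^+ k)].

Definition is_radical S : Prop := radical S `<=` S.

Definition noetherian : Prop :=
  forall K, is_ideal K -> exists s : seq R, K = ideal_gen [set` s].

Definition reduced : Prop := forall (x : R) (k : nat), x ^+ k = 0 -> x = 0.

End Ideals.

Section Quotient.
Variables (R : comPzRingType) (a : ideal R).

Definition ideal_pred : {pred R} := fun x => `[< ideal_set a x >].

Lemma ideal_pred_zmod_closed : zmod_closed ideal_pred.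
Proof.
case: (idealP a) => a0 aD aM; split; first exact/asboolP.
move=> x y /asboolP ax /asboolP ay; apply/asboolP; apply: aD => //.
by rewrite -mulN1r; apply: aM.
Qed.

HB.instance Definition _ :=
  GRing.isZmodClosed.Build R ideal_pred ideal_pred_zmod_closed.

(* ring_quotient.v only provides the ring structure for proper ideals of
   nonzero rings; its quotient of additive groups is general. *)
Definition quot_ring : Type := Quotient.quot ideal_pred.
HB.instance Definition _ := GRing.Zmodule.on quot_ring.

Definition quot_map (x : R) : quot_ring := \pi_(Quotient.quot ideal_pred)%qT x.

Lemma quot_mapK (x : quot_ring) : quot_map (repr x) = x.
Proof. exact: reprK. Qed.

Lemma quot_map_eq x y : quot_map x = quot_map y <-> ideal_set a (x - y).
Proof.
split=> [/eqP|h]; first by rewrite /quot_map -Quotient.idealrBE => /asboolP.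
by apply/eqP; rewrite /quot_map -Quotient.idealrBE; apply/asboolP.
Qed.

Lemma quot_mapB x y : quot_map (x - y) = quot_map x - quot_map y.
Proof. by rewrite /quot_map !piE. Qed.

Definition quot_one : quot_ring := quot_map 1.
Definition quot_mul (x y : quot_ring) := quot_map (repr x * repr y).

Lemma quot_mapM x y : quot_map (x * y) = quot_mul (quot_map x) (quot_map y).
Proof.
apply/quot_map_eq; case: (idealP a) => _ aD aM.
have [/quot_map_eq hx /quot_map_eq hy] :=
  (esym (quot_mapK (quot_map x)), esym (quot_mapK (quot_map y))).
set x' := repr _ in hx *; set y' := repr _ in hy *.
have -> : x * y - x' * y' = y * (x - x') + x' * (y - y') by ring.
by apply: aD; apply: aM.
Qed.

Lemma quot_mapD x y : quot_map (x + y) = quot_map x + quot_map y.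
Proof. by rewrite /quot_map !piE. Qed.

Lemma quot_mulA : associative quot_mul.
Proof.
by move=> x y z; rewrite -[x]quot_mapK -[y]quot_mapK -[z]quot_mapK
  -!quot_mapM mulrA.
Qed.

Lemma quot_mulC : commutative quot_mul.
Proof. by move=> x y; rewrite /quot_mul mulrC. Qed.

Lemma quot_mul1 : left_id quot_one quot_mul.
Proof. by move=> x; rewrite -[x]quot_mapK -quot_mapM mul1r. Qed.

Lemma quot_mulDl : left_distributive quot_mul +%R.
Proof.
move=> x y z; rewrite -[x]quot_mapK -[y]quot_mapK -[z]quot_mapK.
by rewrite -quot_mapD -!quot_mapM -quot_mapD mulrDl.
Qed.

HB.instance Definition _ := GRing.Zmodule_isComPzRing.Build quot_ring
  quot_mulA quot_mulC quot_mul1 quot_mulDl.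

Lemma quot_map_zmod_morphism : zmod_morphism quot_map.
Proof. exact: quot_mapB. Qed.

Lemma quot_map_monoid_morphism : monoid_morphism quot_map.
Proof. by split=> // x y; rewrite quot_mapM. Qed.

HB.instance Definition _ :=
  GRing.isZmodMorphism.Build R quot_ring quot_map quot_map_zmod_morphism.
HB.instance Definition _ :=
  GRing.isMonoidMorphism.Build R quot_ring quot_map quot_map_monoid_morphism.

End Quotient.

Section Spectrum.
Variable R : comPzRingType.

Record Spec := PrimeIdeal {
  prime_ideal :> ideal R;
  prime_proper : ~ ideal_set prime_ideal 1;
  primeP : forall x y, ideal_set prime_ideal (x * y) ->
    ideal_set prime_ideal x \/ ideal_set prime_ideal y }.

HB.instance Definition _ := gen_eqMixin Spec.
HB.instance Definition _ := gen_choiceMixin Spec.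

Lemma Spec_ext (p q : Spec) : (p : set R) = q -> p = q.
Proof.
case: p q => [[p hp] p1 pM] [[q hq] q1 qM] /= e.
by subst q; rewrite (Prop_irrelevance hq hp) in q1 qM *; congr PrimeIdeal;
  exact: Prop_irrelevance.
Qed.

Definition vanishing (S : set R) : set Spec := [set p | S `<=` (p : set R)].

Definition zariski_open (O : set Spec) : Prop :=
  exists S, O = ~` vanishing S.

Lemma zariski_openT : zariski_open setT.
Proof.
exists [set 1]; rewrite -[LHS]setCK setCT; congr (~` _).
by apply/seteqP; split=> // p /(_ 1 erefl) /prime_proper.
Qed.

Lemma zariski_openI : setI_closed zariski_open.
Proof.
move=> _ _ [S ->] [T ->]; exists [set z | exists x y, [/\ S x, T y & z = x * y]].
rewrite -setCU; congr (~` _); apply/seteqP; split=> p /=.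
  case: (idealP p) => _ _ pM [hp|hp] _ [x [y [Sx Ty ->]]].
    by rewrite mulrC; apply: pM; exact: hp.
  by apply: pM; exact: hp.
move=> hp; have [|/existsNP [x /not_implyP [Sx px]]] := pselect (S `<=` (p : set R)).
  by left.
by right=> y Ty; case: (@primeP p x y) => //; apply: hp; exists x, y.
Qed.

Lemma zariski_open_bigU (J : Type) (f : J -> set Spec) :
  (forall i, zariski_open (f i)) -> zariski_open (\bigcup_i f i).
Proof.
move=> /choice [S fS]; exists (\bigcup_i S i).
rewrite -[LHS]setCK setC_bigcup; congr (~` _); apply/seteqP; split=> p /=.
  by move=> hp x [i _ Six]; move: (hp i Logic.I); rewrite fS setCK; exact.
by move=> hp i _; rewrite fS setCK => x Six; apply: hp; exists i.
Qed.

HB.instance Definition _ := isOpenTopological.Build Spec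
  zariski_openT zariski_openI zariski_open_bigU.

End Spectrum.

Definition locally_closed (X : topologicalType) (Y : set X) : Prop :=
  exists O C, [/\ open O, closed C & Y = O `&` C].

Section Localization.
Variables (R : comPzRingType) (p : Spec R).

Definition denom : Type := {s : R | `[< ~ ideal_set p s >]}.
HB.instance Definition _ := SubChoice.on denom.

Let denomP (s : denom) : ~ ideal_set p (val s).
Proof. exact/asboolP/(valP s). Qed.

Let denom1P : `[< ~ ideal_set p 1 >].
Proof. exact/asboolP/prime_proper. Qed.

Definition denom1 : denom := exist _ 1 denom1P.

Let denomM (s t : R) : ~ ideal_set p s -> ~ ideal_set p t -> ~ ideal_set p (s * t).
Proof. by move=> ps pt /primeP []. Qed.

Definition loc_equiv (x y : R * denom) : bool :=
  `[< exists2 u, ~ ideal_set p u & u * (x.1 * val y.2) = u * (y.1 * val x.2) >].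

Lemma loc_equiv_is_equiv : equiv_class_of loc_equiv.
Proof.
split=> [x|x y|y x z].
- by apply/asboolP; exists 1; first exact: prime_proper.
- by apply/asboolP/asboolP => -[u pu e]; exists u.
move=> /asboolP [u pu e] /asboolP [v pv f]; apply/asboolP.
exists (u * v * val y.2); first by apply: denomM => //; exact: denomM.
transitivity (v * val z.2 * (u * (x.1 * val y.2))); first by ring.
rewrite e; transitivity (u * val x.2 * (v * (y.1 * val z.2))); first by ring.
by rewrite f; ring.
Qed.

Canonical loc_equiv_equiv := EquivRelPack loc_equiv_is_equiv.
Canonical loc_equiv_encModRel := defaultEncModRel loc_equiv.

Definition loc : Type := {eq_quot loc_equiv}%qT.
HB.instance Definition _ := Choice.on loc.

(* The fraction r / s of the localization at p, meaningful when s is not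
   in p. *)
Definition frac (r s : R) : loc :=
  (\pi_({eq_quot loc_equiv}) (r, insubd denom1 s))%qT.

Lemma fracP (x : loc) : exists r s, ~ ideal_set p s /\ x = frac r s.
Proof.
exists (repr x).1, (val (repr x).2); split; first exact: denomP.
by rewrite /frac valKd -surjective_pairing; exact: esym (reprK x).
Qed.

Lemma frac_eq r s r' s' : ~ ideal_set p s -> ~ ideal_set p s' ->
  frac r s = frac r' s' <->
  exists2 u, ~ ideal_set p u & u * (r * s') = u * (r' * s).
Proof.
move=> ps ps'; rewrite /frac.
have e t : ~ ideal_set p t -> val (insubd denom1 t) = t.
  by move=> pt; rewrite insubdK // unfold_in; exact/asboolP.
split=> [/eqmodP /asboolP /=|h]; first by rewrite !e.
by apply/eqmodP/asboolP; rewrite /= !e.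
Qed.

Let num (x : loc) : R := (repr x).1.
Let den (x : loc) : R := val (repr x).2.

Let denP x : ~ ideal_set p (den x). Proof. exact: denomP. Qed.

Let frac_numden x : frac (num x) (den x) = x.
Proof. by rewrite /frac valKd -surjective_pairing; exact: reprK. Qed.

Definition loc_add x y : loc := frac (num x * den y + num y * den x) (den x * den y).
Definition loc_opp x : loc := frac (- num x) (den x).
Definition loc_mul x y : loc := frac (num x * num y) (den x * den y).

Let frac_numdenE r s : ~ ideal_set p s ->
  exists2 u, ~ ideal_set p u &
    u * (num (frac r s) * s) = u * (r * den (frac r s)).
Proof. by move=> ps; apply/frac_eq; rewrite ?frac_numden. Qed.

Lemma fracD r s r' s' : ~ ideal_set p s -> ~ ideal_set p s' ->
  loc_add (frac r s) (frac r' s') = frac (r * s' + r' * s) (s * s').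
Proof.
move=> ps ps'.
have [u pu e] := frac_numdenE r ps; have [u' pu' e'] := frac_numdenE r' ps'.
apply/frac_eq; try exact: denomM; exists (u * u'); first exact: denomM.
set n := num _ in e *; set d := den _ in e *.
set n' := num _ in e' *; set d' := den _ in e' *.
transitivity (u' * d' * s' * (u * (n * s)) + u * d * s * (u' * (n' * s')));
  first by ring.
by rewrite e e'; ring.
Qed.

Lemma fracM r s r' s' : ~ ideal_set p s -> ~ ideal_set p s' ->
  loc_mul (frac r s) (frac r' s') = frac (r * r') (s * s').
Proof.
move=> ps ps'.
have [u pu e] := frac_numdenE r ps; have [u' pu' e'] := frac_numdenE r' ps'.
apply/frac_eq; try exact: denomM; exists (u * u'); first exact: denomM.
set n := num _ in e *; set d := den _ in e *.
set n' := num _ in e' *; set d' := den _ in e' *.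
transitivity (u * (n * s) * (u' * (n' * s'))); first by ring.
by rewrite e e'; ring.
Qed.

Lemma fracN r s : ~ ideal_set p s -> loc_opp (frac r s) = frac (- r) s.
Proof.
move=> ps; have [u pu e] := frac_numdenE r ps.
apply/frac_eq => //; exists u => //.
by rewrite !mulNr !mulrN e.
Qed.

Let frac_ringeq r s r' s' : ~ ideal_set p s -> ~ ideal_set p s' ->
  r * s' = r' * s -> frac r s = frac r' s'.
Proof.
by move=> ps ps' e; apply/frac_eq => //; exists 1; rewrite ?e //;
  exact: prime_proper.
Qed.

Let p1 : ~ ideal_set p 1. Proof. exact: prime_proper. Qed.

Lemma loc_addA : associative loc_add.
Proof.
move=> x y z; have [r [s [ps ->]]] := fracP x.
have [r' [s' [ps' ->]]] := fracP y; have [r'' [s'' [ps'' ->]]] := fracP z.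
rewrite !fracD //; try exact: denomM.
by apply: frac_ringeq; try (by repeat apply: denomM); ring.
Qed.

Lemma loc_addC : commutative loc_add.
Proof.
by move=> x y; rewrite /loc_add addrC [den y * den x]mulrC.
Qed.

Lemma loc_add0 : left_id (frac 0 1) loc_add.
Proof.
move=> x; have [r [s [ps ->]]] := fracP x; rewrite fracD //.
by apply: frac_ringeq; rewrite ?mul1r //; ring.
Qed.

Lemma loc_addN : left_inverse (frac 0 1) loc_opp loc_add.
Proof.
move=> x; have [r [s [ps ->]]] := fracP x; rewrite fracN // fracD //.
by apply: frac_ringeq; try (by repeat apply: denomM); ring.
Qed.

HB.instance Definition _ :=
  GRing.isZmodule.Build loc loc_addA loc_addC loc_add0 loc_addN.

Lemma loc_mulA : associative loc_mul.
Proof.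
move=> x y z; have [r [s [ps ->]]] := fracP x.
have [r' [s' [ps' ->]]] := fracP y; have [r'' [s'' [ps'' ->]]] := fracP z.
by rewrite !fracM //; try exact: denomM; rewrite !mulrA.
Qed.

Lemma loc_mulC : commutative loc_mul.
Proof. by move=> x y; rewrite /loc_mul mulrC [den y * den x]mulrC. Qed.

Lemma loc_mul1 : left_id (frac 1 1) loc_mul.
Proof.
by move=> x; have [r [s [ps ->]]] := fracP x; rewrite fracM // !mul1r.
Qed.

Lemma loc_mulDl : left_distributive loc_mul loc_add.
Proof.
move=> x y z; have [r [s [ps ->]]] := fracP x.
have [r' [s' [ps' ->]]] := fracP y; have [r'' [s'' [ps'' ->]]] := fracP z.
rewrite fracD // !fracM // ?fracD //; try exact: denomM.
by apply: frac_ringeq; try (by repeat apply: denomM); ring.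
Qed.

HB.instance Definition _ := GRing.Zmodule_isComPzRing.Build loc
  loc_mulA loc_mulC loc_mul1 loc_mulDl.

Definition to_loc (r : R) : loc := frac r 1.

Definition residue : Type :=
  quot_ring (ideal_gen (to_loc @` (prime_ideal p : set R))).
HB.instance Definition _ := GRing.ComPzRing.on residue.

Definition loc_residue (x : loc) : residue := quot_map _ x.

Definition to_residue (r : R) : residue := loc_residue (to_loc r).

End Localization.

(* Polynomials with terms in a monoid T of power products, later 'X_{1..n};
   [malg] carries a ring structure only over nonzero coefficient rings. *)
Definition polyring (T : conomType) (R : comPzRingType) : Type :=
  {malg R[T]}.
HB.instance Definition _ T R := GRing.Zmodule.on (polyring T R).

HB.lock Definition pol_mul (T : conomType) (R : comPzRingType) (P Q : polyring T R) :
    polyring T R :=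
  \sum_(s <- msupp P) \sum_(t <- msupp Q) << P@_s * Q@_t *g (s * t)%M >>.

Section PolynomialRing.
Variables (T : conomType) (R : comPzRingType).
Implicit Types P Q : polyring T R.
Local Notation pol_mul := (@pol_mul T R).

Definition pol_one : polyring T R := << 1 *g 1%M >>.

Lemma pol_mulEw (D E : {fset T}) P Q :
  (msupp P `<=` D)%fset -> (msupp Q `<=` E)%fset ->
  pol_mul P Q = \sum_(s <- D) \sum_(t <- E) << P@_s * Q@_t *g (s * t)%M >>.
Proof.
move=> PD QE; rewrite unlock (big_fset_incl _ PD) /=.
  apply/eq_bigr=> s _; apply/big_fset_incl => // t _ /mcoeff_outdom ->.
  by rewrite mulr0 monalgU0.
move=> s _ /mcoeff_outdom Ps.
by rewrite big1 // => t _; rewrite Ps mul0r monalgU0.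
Qed.

Lemma pol_mulC : commutative pol_mul.
Proof.
move=> P Q; rewrite unlock exchange_big; apply: eq_bigr => t _.
by apply: eq_bigr => s _; rewrite mulrC mulmC.
Qed.

Lemma pol_mulDl : left_distributive pol_mul +%R.
Proof.
move=> P Q S; rewrite (pol_mulEw (msuppD_le P Q) (fsubset_refl _)).
rewrite (pol_mulEw (fsubsetUl _ (msupp Q)) (fsubset_refl _)).
rewrite (pol_mulEw (fsubsetUr (msupp P) _) (fsubset_refl _)).
rewrite -big_split /=; apply: eq_bigr => s _.
rewrite -big_split /=; apply: eq_bigr => t _.
by rewrite mcoeffD mulrDl monalgUD.
Qed.

Lemma pol_mulDr : right_distributive pol_mul +%R.
Proof. by move=> P Q S; rewrite ![pol_mul P _]pol_mulC pol_mulDl. Qed.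

Lemma pol_mul0l : left_zero 0 pol_mul.
Proof. by move=> P; rewrite unlock msupp0 big_seq_fset0. Qed.

Lemma pol_mul0r : right_zero 0 pol_mul.
Proof. by move=> P; rewrite pol_mulC pol_mul0l. Qed.

Lemma pol_mulUU (c d : R) (s t : T) :
  pol_mul << c *g s >> << d *g t >> = << c * d *g (s * t)%M >>.
Proof.
by rewrite (pol_mulEw msuppU_le msuppU_le) !big_seq_fset1 !mcoeffUU.
Qed.

Lemma pol_ind (Pr : polyring T R -> Prop) :
  Pr 0 -> (forall P Q, Pr P -> Pr Q -> Pr (P + Q)) ->
  (forall c s, Pr << c *g s >>) -> forall P, Pr P.
Proof.
by move=> Pr0 PrD PrU P; rewrite [P]monalgE; apply: big_ind.
Qed.

Lemma pol_mulA : associative pol_mul.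
Proof.
move=> P Q S; elim/pol_ind: P => [|P P' hP hP'|c s].
- by rewrite !pol_mul0l.
- by rewrite !pol_mulDl hP hP'.
elim/pol_ind: Q => [|Q Q' hQ hQ'|d t].
- by rewrite pol_mul0l !pol_mul0r pol_mul0l.
- by rewrite pol_mulDl !pol_mulDr hQ hQ' pol_mulDl.
elim/pol_ind: S => [|S S' hS hS'|e u].
- by rewrite !pol_mul0r.
- by rewrite !pol_mulDr hS hS'.
by rewrite !pol_mulUU mulrA mulmA.
Qed.

Lemma pol_mul1 : left_id pol_one pol_mul.
Proof.
move=> P; elim/pol_ind: P => [|P Q hP hQ|c s].
- by rewrite pol_mul0r.
- by rewrite pol_mulDr hP hQ.
by rewrite pol_mulUU mul1r mul1m.
Qed.

HB.instance Definition _ := GRing.Zmodule_isComPzRing.Build (polyring T R)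
  pol_mulA pol_mulC pol_mul1 pol_mulDl.

End PolynomialRing.

Definition map_coef (T : conomType) (R S : comPzRingType) (f : R -> S)
    (P : polyring T R) : polyring T S :=
  [malg t in msupp P => f P@_t].

Section Terms.
Variables (T : conomType) (ord : rel T).

Definition term_order : Prop :=
  [/\ total ord, antisymmetric ord, transitive ord, forall t, ord 1%M t
    & forall s t u, ord s t -> ord (s * u)%M (t * u)%M].

Definition tdvd (s t : T) : Prop := exists u, t = (s * u)%M.

Definition minimal_terms (L : set T) : set T :=
  [set t | L t /\ forall s, L s -> tdvd s t -> s = t].

Section Leading.
Variable R : comPzRingType.
Implicit Types (P : polyring T R) (K G : set (polyring T R)).

(* lterm 0 = 1 is a dummy value. *)
Definition lterm P : T := last 1%M (sort ord (msupp P)).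

Definition lcoef P : R := P@_(lterm P).

Definition lterms K : set T := [set lterm P | P in K `\ 0].

Definition lcoef_ideal K (t : T) : set R :=
  [set lcoef P | P in [set P | (K `\ 0) P /\ lterm P = t]] `|` [set 0].

Definition lucky K (p : Spec R) : Prop :=
  forall t, lterms K t -> ~ (lcoef_ideal K t `<=` (p : set R)).

Definition singular_ideal K : set R :=
  radical (\big[@ideal_mul R/setT]_(t \in minimal_terms (lterms K)) lcoef_ideal K t).

Definition groebner_basis K G : Prop :=
  [/\ finite_set G, G `<=` K `\ 0
    & forall t, lterms K t -> exists2 g, G g & tdvd (lterm g) t].

Definition reduced_groebner_basis K G : Prop :=
  [/\ groebner_basis K G, forall g, G g -> lcoef g = 1
    & forall g h t, G g -> G h -> h <> g -> t \in msupp g -> ~ tdvd (lterm h) t].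

End Leading.
End Terms.

Section Sections.
Variables (R : comPzRingType) (U : set (Spec R)).

(* Sections over U of the structure sheaf of Spec R, for U open. *)
Definition regular (s : forall q : U, loc (val q)) : Prop :=
  forall q : U, exists V : set (Spec R), [/\ open V, V (val q) &
    exists r f, forall q' : U, V (val q') ->
      ~ ideal_set (val q') f /\ s q' = frac (val q') r f].

Record sections := Section {
  germ : forall q : U, loc (val q); germP : regular germ }.

HB.instance Definition _ := gen_eqMixin sections.
HB.instance Definition _ := gen_choiceMixin sections.

Lemma sections_ext (s t : sections) : (forall q, germ s q = germ t q) -> s = t.
Proof.
case: s t => [s hs] [t ht] /= e.
have {}e : s = t by exact: functional_extensionality_dep.
by subst t; congr Section; exact: Prop_irrelevance.
Qed.

Lemma regular_cst (r : R) : regular (fun q => to_loc (val q) r).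
Proof.
move=> q; exists setT; split=> //; first exact: openT.
by exists r, 1 => q' _; split=> //; exact: prime_proper.
Qed.

Lemma regular_op2 (op : forall q : Spec R, loc q -> loc q -> loc q)
    (num : R -> R -> R -> R -> R) :
  (forall q r f r' f', ~ ideal_set (prime_ideal q) f -> ~ ideal_set q f' ->
     op q (frac q r f) (frac q r' f') = frac q (num r f r' f') (f * f')) ->
  forall s t : sections, regular (fun q => op (val q) (germ s q) (germ t q)).
Proof.
move=> opE s t q.
have [V [oV Vq [r [f hs]]]] := germP s q.
have [W [oW Wq [r' [f' ht]]]] := germP t q.
exists (V `&` W); split=> //; first exact: openI.
exists (num r f r' f'), (f * f') => q' [/hs [qf ->] /ht [qf' ->]].
by split; [case/primeP|exact: opE].
Qed.

Lemma regular_opp (s : sections) : regular (fun q => - germ s q).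
Proof.
move=> q; have [V [oV Vq [r [f hs]]]] := germP s q.
exists V; split=> //; exists (- r), f => q' /hs [qf ->].
by split=> //; exact: fracN.
Qed.

Definition sec_zero : sections := Section (regular_cst 0).
Definition sec_one : sections := Section (regular_cst 1).
Definition sec_opp (s : sections) : sections := Section (regular_opp s).
Definition sec_add (s t : sections) : sections :=
  Section (regular_op2 (@fracD R) s t).
Definition sec_mul (s t : sections) : sections :=
  Section (regular_op2 (@fracM R) s t).

Lemma sec_addA : associative sec_add.
Proof. by move=> s t u; apply: sections_ext => q; exact: addrA. Qed.
Lemma sec_addC : commutative sec_add.
Proof. by move=> s t; apply: sections_ext => q; exact: addrC. Qed.
Lemma sec_add0 : left_id sec_zero sec_add.
Proof. by move=> s; apply: sections_ext => q; exact: add0r. Qed.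
Lemma sec_addN : left_inverse sec_zero sec_opp sec_add.
Proof. by move=> s; apply: sections_ext => q; exact: addNr. Qed.

HB.instance Definition _ :=
  GRing.isZmodule.Build sections sec_addA sec_addC sec_add0 sec_addN.

Lemma sec_mulA : associative sec_mul.
Proof. by move=> s t u; apply: sections_ext => q; exact: mulrA. Qed.
Lemma sec_mulC : commutative sec_mul.
Proof. by move=> s t; apply: sections_ext => q; exact: mulrC. Qed.
Lemma sec_mul1 : left_id sec_one sec_mul.
Proof. by move=> s; apply: sections_ext => q; exact: mul1r. Qed.
Lemma sec_mulDl : left_distributive sec_mul sec_add.
Proof. by move=> s t u; apply: sections_ext => q; exact: mulrDl. Qed.

HB.instance Definition _ := GRing.Zmodule_isComPzRing.Build sections
  sec_mulA sec_mulC sec_mul1 sec_mulDl.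

(* Sections over U of the quasi-coherent sheaf associated to the R-module
   K (an ideal of R[x]), that is, families in the localizations of K that are
   locally of the form P / f with P in K and f in R. They are regarded as
   polynomials over [sections], by collecting coefficients: map_coef germ is
   the stalk of such a polynomial. *)
Definition ideal_sections (T : conomType) (K : set (polyring T R)) :
    set (polyring T sections) :=
  [set g | forall q : U, exists V : set (Spec R), [/\ open V, V (val q) &
    exists P f, K P /\ forall q' : U, V (val q') ->
      ~ ideal_set (val q') f /\
      map_coef (fun s => germ s q') g = map_coef (fun c => frac (val q') c f) P]].

End Sections.

Arguments ideal_sections {R} U {T} K.

Section ClosedSubscheme.
Variables (A : comPzRingType) (a : ideal A).

Let preim (q : Spec (quot_ring a)) : set A := quot_map a @^-1` (q : set _).

Lemma contract_is_ideal (q : Spec (quot_ring a)) : is_ideal (preim q).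
Proof.
case: (idealP q) => q0 qD qM; rewrite /preim; split=> [|x y|r x] /=.
- by rewrite raddf0.
- by rewrite raddfD; exact: qD.
by rewrite rmorphM; exact: qM.
Qed.

Lemma contract_proper (q : Spec (quot_ring a)) : ~ preim q 1.
Proof. by rewrite /preim /= rmorph1; exact: prime_proper. Qed.

Lemma contract_prime (q : Spec (quot_ring a)) x y :
  preim q (x * y) -> preim q x \/ preim q y.
Proof. by rewrite /preim /= rmorphM; exact: primeP. Qed.

(* The closed embedding Spec(A/a) -> Spec(A), identifying Spec(A/a) with V(a)
   by the next two lemmas. *)
Definition contract (q : Spec (quot_ring a)) : Spec A :=
  @PrimeIdeal A (Ideal (contract_is_ideal q))
    (contract_proper (q := q)) (contract_prime (q := q)).

Lemma contract_inj : injective contract.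
Proof.
move=> q q' /(congr1 (fun p : Spec A => (p : set A))) /= e; apply: Spec_ext.
by apply/seteqP; split=> x; rewrite -[x]quot_mapK => qx;
  [have : preim q' (repr x) by rewrite -e | have : preim q (repr x) by rewrite e].
Qed.

Lemma range_contract : range contract = vanishing a.
Proof.
apply/seteqP; split=> [_ [q _ <-] x ax|p ap].
  rewrite /= /preim /=; have -> : quot_map a x = 0.
    by rewrite -[RHS](raddf0 (quot_map a)); apply/quot_map_eq; rewrite subr0.
  by case: (idealP q).
have pD (x y : A) : quot_map a x = quot_map a y ->
    ideal_set p x -> ideal_set p y.
  move=> /quot_map_eq /ap pxy px; case: (idealP p) => _ pD pM.
  have -> : y = x + (-1) * (x - y) by ring.
  by apply: pD => //; exact: pM.
pose Q := [set x : quot_ring a | ideal_set p (repr x)].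
have QE x : Q (quot_map a x) <-> ideal_set p x.
  by split; apply: pD; rewrite quot_mapK.
have hQ : is_ideal Q.
  case: (idealP p) => p0 pA pM; split.
  - by rewrite -(raddf0 (quot_map a)); apply/QE.
  - move=> x y; rewrite -[x]quot_mapK -[y]quot_mapK -raddfD => /QE px /QE py.
    by apply/QE; exact: pA.
  move=> r x; rewrite -[x]quot_mapK -[r]quot_mapK -rmorphM => /QE px.
  by apply/QE; exact: pM.
have Q1 : ~ ideal_set (Ideal hQ) 1.
  by rewrite /= -(rmorph1 (quot_map a)) => /QE; exact: prime_proper.
have QM x y : ideal_set (Ideal hQ) (x * y) ->
    ideal_set (Ideal hQ) x \/ ideal_set (Ideal hQ) y.
  rewrite /= -[x]quot_mapK -[y]quot_mapK -rmorphM => /QE /primeP [px|py].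
    by left; apply/QE.
  by right; apply/QE.
exists (PrimeIdeal Q1 QM) => //; apply: Spec_ext.
by apply/seteqP; split=> x /QE.
Qed.

(* The natural map (A/a)_q -> k(p), p the contraction of q, computed on
   representatives; see [loc_to_residueE]. *)
Definition loc_to_residue (q : Spec (quot_ring a)) (x : loc q) :
    residue (contract q) :=
  loc_residue (frac (contract q) (repr (repr x).1) (repr (val (repr x).2))).

Lemma loc_to_residueE (q : Spec (quot_ring a)) (r s : A) :
  ~ ideal_set (contract q) s ->
  loc_to_residue (frac q (quot_map a r) (quot_map a s)) =
  loc_residue (frac (contract q) r s).
Proof.
move=> qs; rewrite /loc_to_residue; set x := frac q _ _.
set N := repr (repr x).1; set D := repr (val (repr x).2).
have qD : ~ ideal_set (contract q) D.
  by rewrite /= /preim /= quot_mapK; exact/asboolP/(valP (repr x).2).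
have xE : frac q (quot_map a N) (quot_map a D) = x.
  by rewrite !quot_mapK /frac valKd -surjective_pairing; exact: reprK.
have [u qu e] : exists2 u, ~ ideal_set q u &
    u * (quot_map a N * quot_map a s) = u * (quot_map a r * quot_map a D).
  by apply/frac_eq.
have pND : ideal_set (contract q) (N * s - r * D).
  have /primeP [] // : ideal_set q (u * quot_map a (N * s - r * D)).
  rewrite rmorphB !rmorphM mulrBr e subrr.
  by case: (idealP q).
apply/quot_map_eq; have -> : frac (contract q) N D - frac (contract q) r s =
    frac (contract q) 1 (D * s) * to_loc (contract q) (N * s - r * D).
  rewrite [X in _ + X](fracN _ qs) [LHS](fracD _ _ qD qs).
  have qDs : ~ ideal_set (contract q) (D * s) by move=> /primeP [].
  rewrite [RHS](fracM _ _ qDs (@prime_proper _ (contract q))).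
  by congr frac; ring.
move=> J hJ SJ; case: (hJ) => _ _ JM; apply: JM; apply: SJ.
by exists (N * s - r * D).
Qed.

End ClosedSubscheme.

Definition closure_ideal (A : comPzRingType) (Y : set (Spec A)) (a : ideal A) : Prop :=
  is_radical a /\ closure Y = vanishing a.

Definition image_ideal (A : comPzRingType) (T : conomType)
    (I : set (polyring T A)) (a : ideal A) : set (polyring T (quot_ring a)) :=
  map_coef (quot_map a) @` I.
Arguments image_ideal {A T} I a.

Definition fiber_ideal (A : comPzRingType) (T : conomType)
    (I : set (polyring T A)) (p : Spec A) : set (polyring T (residue p)) :=
  ideal_gen (map_coef (@to_residue A p) @` I).
Arguments fiber_ideal {A T} I p.

Definition specialize (A : comPzRingType) (T : conomType) (a : ideal A)
    (U : set (Spec (quot_ring a))) (q : U) (g : polyring T (sections U)) :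
    polyring T (residue (contract (val q))) :=
  map_coef (fun s => loc_to_residue (germ s q)) g.

(* The ideal a is uniquely determined by Y, and U is Y seen in Spec(A/a). *)
Definition parametric (A : comPzRingType) (T : conomType) (ord : rel T)
    (I : set (polyring T A)) (Y : set (Spec A)) : Prop :=
  exists2 a : ideal A, closure_ideal Y a &
  let U : set (Spec (quot_ring a)) := @contract A a @^-1` Y in
  exists G : set (polyring T (sections U)),
    [/\ finite_set G, G `<=` ideal_sections U (image_ideal I a),
        forall q : U, reduced_groebner_basis ord
          (fiber_ideal I (contract (val q))) (specialize q @` G)
      & forall g, G g -> forall q q' : U,
          lterm ord (specialize q g) = lterm ord (specialize q' g)].

(* Main.v *)
Require Import Defs.
From HB Require Import structures.
From mathcomp Require Import all_boot all_order all_algebra finmap ring.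
From mathcomp Require Import boolp classical_sets functions cardinality.
From mathcomp Require Import fsbigop topology.
From mathcomp Require Import monalg.

(** Write R = A/a, K for the image of I in R[x], and U for Y seen in Spec(R).
    Up to units of the residue field k(q), the elements of the fiber ideal at a
    point q of U are the reductions modulo q of the elements of K
    ([fiber_idealP]), so everything can be read off from which coefficients of
    elements of K lie in q.

    Suppose that every q in U is lucky. A term of lt(K) can then be cancelled
    from a polynomial P of K by an element Q of K whose leading coefficient c
    is not in q: c P - P_u Q has lost its term u, and apart from terms smaller
    than u it differs from P only by the factor c, a unit at q. Doing this to the top terms of P shows that passing to the fiber
    creates no new leading term ([lucky_lterms]). Doing it to the terms below
    t = lt(P) yields, for each t in lt(K), a normal polynomial: an element P of
    K with P_t not in q whose other terms are smaller than t and outside lt(K)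
    ([exists_normal]). A normal polynomial is determined by P_t, because the
    difference of two of them with the same coefficient at t has no possible
    leading term. Hence the fractions P / P_t agree where they are defined and
    glue to a section g_t over U with coefficient 1 at t
    ([exists_normal_section]). Its support is finite because the coefficients
    P_t of all normal polynomials form an ideal of R: finitely many P, lifting
    generators of this ideal, describe g_t everywhere. When t runs over the
    minimal elements of lt(K), finite in number by Dickson's lemma, the g_t
    specialize to reduced Groebner bases with constant leading terms
    ([parametric_of_lucky]).

    Conversely let G witness that Y is parametric, let q be in U and t = lt(P)
    with P in K. Since a is the intersection of the primes in Y
    ([closure_ideal_sub]), the nonzero leading coefficient of P avoids some q0
    in U. There t is a leading term of the fiber ideal, so the leading term s
    of some g in G divides t at q0, hence at all points of U. Near q write
    g = Q / f with Q in K, on a neighbourhood where some h does not vanish.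
    The coefficients of Q at terms that are not below s vanish at each point of
    U in this neighbourhood, so h times such a coefficient lies in all primes
    of U, and is 0. Thus h Q has leading term s and a leading coefficient
    outside q, and so has t after multiplication by t / s
    ([lucky_of_parametric]).

    Finally a prime contains the radical of a product of finitely many ideals
    if and only if it contains one of them, and luckiness need only be tested
    on the minimal terms, as lc(K, s) is contained in lc(K, t) when s divides t
    ([luckyP]). *)

Set Implicit Arguments.
Unset Strict Implicit.
Unset Printing Implicit Defensive.

Import GRing.Theory.

Local Open Scope classical_set_scope.
Local Open Scope ring_scope.

Local Notation "1" := (@mone _) : monom_scope.
Local Notation "s * t" := (mmul s t) : monom_scope.
Local Notation frac := Defs.frac.
Local Notation primeP := Defs.primeP.

(** * Dickson's lemma and well-foundedness of term orders *)

Section Dickson.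

(** Pick repeatedly an index where the tail of the sequence that starts after
    the last choice is minimal. *)
Lemma nondecreasing_subsequence (u : nat -> nat) : exists f : nat -> nat,
  {homo f : i j / (i < j)%N} /\ {homo (fun i => u (f i)) : i j / (i <= j)%N}.
Proof.
have /choice[m mP] N : exists m, (N <= m)%N /\ forall k, (N <= k)%N -> (u m <= u k)%N.
  have exv : exists v, `[< exists2 k, (N <= k)%N & u k = v >].
    by exists (u N); apply/asboolP; exists N.
  have [v /asboolP[k Nk <-] vmin] := ex_minnP exv.
  by exists k; split=> // j Nj; apply: vmin; apply/asboolP; exists j.
pose f := fix f i := if i is j.+1 then m (f j).+1 else m 0%N.
have fS i : (f i < f i.+1)%N by have [] := mP (f i).+1.
exists f; split; first exact: homo_ltn ltn_trans fS.
apply: homo_leq leq_trans _ => // i.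
(* Both [f i] and [f i.+1] lie in the tail over which [f i] is minimal. *)
have [N [fE Nle]] : exists N, f i = m N /\ (N <= f i)%N.
  by case: i => [|i]; [exists 0%N|exists (f i).+1; split=> //; have [] := mP (f i).+1].
by rewrite fE; apply: (mP N).2; rewrite (leq_trans Nle) // ltnW.
Qed.

Variable n : nat.
Implicit Types (s t : 'X_{1..n}) (L : set 'X_{1..n}).

(** Extract successively for each variable: a subsequence of a nondecreasing
    sequence is still nondecreasing. *)
Lemma dickson_subsequence (u : nat -> 'X_{1..n}) : exists f : nat -> nat,
  {homo f : i j / (i < j)%N} /\
  forall k : 'I_n, {homo (fun i => u (f i) k) : i j / (i <= j)%N}.
Proof.
suff H m : exists f : nat -> nat, {homo f : i j / (i < j)%N} /\
    forall k : 'I_n, (k < m)%N -> {homo (fun i => u (f i) k) : i j / (i <= j)%N}.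
  by have [f [fmono fk]] := H n; exists f; split=> // k; apply: fk.
elim: m => [|m [f [fmono fk]]]; first by exists id; split=> [i j|k].
have [mn|nm] := ltnP m n; last first.
  by exists f; split=> // k _; apply: fk; apply: leq_trans nm.
have [g [gmono gk]] := nondecreasing_subsequence (fun i => u (f i) (Ordinal mn)).
exists (f \o g); split=> [i j ij|k]; first by apply: fmono; exact: gmono.
rewrite ltnS leq_eqVlt => /orP[/eqP km|km] i j ij.
  have -> : k = Ordinal mn by apply: val_inj.
  exact: gk.
apply: (fk _ km); move: ij; rewrite leq_eqVlt => /orP[/eqP -> //|/gmono].
exact: ltnW.
Qed.

Lemma tdvdP s t : tdvd s t <-> forall i, (s i <= t i)%N.
Proof.
split=> [[u ->] i|st]; first by rewrite cmM leq_addr.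
exists (divcm t s); apply/eqP/cmP => i.
by rewrite cmM divcmE subnKC.
Qed.

Lemma tdvd_trans s t u : tdvd s t -> tdvd t u -> tdvd s u.
Proof.
by move=> /tdvdP st /tdvdP tu; apply/tdvdP => i; exact: leq_trans (tu i).
Qed.

Lemma term_mulIm : left_injective (@mmul 'X_{1..n}).
Proof.
move=> u s t e; apply/eqP/cmP => i.
by move/eqP/cmP: e => /(_ i); rewrite !cmM => /addIn.
Qed.

(** An injective sequence of minimal terms would contain two terms that divide
    one another, by [dickson_subsequence]. *)
Lemma finite_minimal_terms L : finite_set (minimal_terms L).
Proof.
apply: contrapT => /infiniteP /card_leP [f].
pose u i := val (f (SigSub (in_setT i))).
have minu i : minimal_terms L (u i) by exact: set_mem (valP (f _)).
have [g [gmono gk]] := dickson_subsequence u.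
have g01 : (g 0 < g 1)%N by exact: gmono.
have : tdvd (u (g 0%N)) (u (g 1%N)) by apply/tdvdP => k; exact: gk.
move=> /((minu _).2 _ (minu _).1) /val_inj /inj.
rewrite !inE => /(_ Logic.I Logic.I) /(congr1 val) e.
by move: g01; rewrite /= in e; rewrite e ltnn.
Qed.

(** By induction on the degree, which drops along proper divisors. *)
Lemma minimal_divisor L t : L t -> exists2 s, minimal_terms L s & tdvd s t.
Proof.
elim: {t}_.+1 {-2}t (ltnSn (mdeg t)) => // d IH t td Lt.
have [tmin|/not_andP[//|nmin]] := pselect (minimal_terms L t).
  by exists t => //; apply/tdvdP.
move: nmin => /existsNP[s /not_implyP[Ls /not_implyP[st /eqP ne]]].
have [|v vmin vs] := IH s _ Ls; last by exists v => //; exact: tdvd_trans st.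
apply: leq_trans (td : _ <= d)%N.
case: st => u tE; rewrite tE mdegM -[X in (X < _)%N]addn0 ltn_add2l lt0n.
rewrite mdeg_eq0; apply: contra ne => /eqP u1.
by rewrite tE u1 mulm1.
Qed.

Variables (ord : rel 'X_{1..n}) (ordP : term_order ord).

Lemma tdvd_ord s t : tdvd s t -> ord s t.
Proof.
case: ordP => _ _ _ one mul [u ->].
by have := mul _ _ s (one u); rewrite mul1m mulmC.
Qed.

(** A term order extends divisibility, so it suffices to look at the finitely
    many terms that are minimal for divisibility. *)
Lemma term_order_min L : L !=set0 -> exists2 s, L s & forall t, L t -> ord s t.
Proof.
case=> t0 Lt0; case: ordP => tot anti tr one mul.
have /finite_seqP[l lE] := finite_minimal_terms L.
have [s1 s1min _] := minimal_divisor Lt0.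
have [s sl smin] : exists2 s, s \in l & forall t, t \in l -> ord s t.
  have {s1min} : s1 \in l by move: s1min; rewrite lE.
  elim: l s1 {lE} => // x l IH s1 _; case: l IH => [_|y l IH].
    exists x; rewrite ?mem_head // => t; rewrite inE => /eqP ->.
    by have := tot x x; rewrite orbb.
  have [s sl smin] := IH y (mem_head _ _).
  have [xs|sx] := orP (tot x s).
    exists x; rewrite ?mem_head // => t; rewrite inE => /orP[/eqP ->|/smin st].
      by have := tot x x; rewrite orbb.
    exact: tr st.
  by exists s => [|t]; rewrite inE ?sl ?orbT // => /orP[/eqP ->|/smin].
have : minimal_terms L s by rewrite lE.
move=> [Ls _]; exists s => // t /minimal_divisor [v vmin vt].
apply: (tr v); first by apply: smin; move: vmin; rewrite lE.
exact: tdvd_ord.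
Qed.

Lemma term_order_ind (Pr : 'X_{1..n} -> Prop) :
  (forall t, (forall s, ord s t -> s <> t -> Pr s) -> Pr t) -> forall t, Pr t.
Proof.
move=> IH; apply: contrapT => /existsNP [t0 nt0].
have [|t nPt tmin] := @term_order_min (fun t => ~ Pr t); first by exists t0.
apply: nPt; apply: IH => s st ne; apply: contrapT => /tmin ts.
by case: ordP => _ anti _ _ _; apply: ne; apply: anti; rewrite st ts.
Qed.

End Dickson.

(** * Coefficients of products and of images of polynomials *)

Section Coefficients.
Variable T : conomType.

Definition monomial (R : comPzRingType) (c : R) (u : T) : polyring T R :=
  << c *g u >>.

Lemma pol_ext (R : comPzRingType) (P Q : polyring T R) :
  (forall t, P@_t = Q@_t) -> P = Q.
Proof. by move/malgP. Qed.

Lemma pol_coefD (R : comPzRingType) (P Q : polyring T R) t :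
  (P + Q)@_t = P@_t + Q@_t.
Proof. exact: mcoeffD. Qed.

Lemma pol_coef0 (R : comPzRingType) t : (0 : polyring T R)@_t = 0.
Proof. exact: mcoeff0. Qed.

Lemma coef_map_coef (R S : comPzRingType) (f : R -> S) (P : polyring T R) t :
  f 0 = 0 -> (map_coef f P)@_t = f P@_t.
Proof.
move=> f0; rewrite /map_coef mcoeffE; case: ifPn => // /mcoeff_outdom ->.
by rewrite f0.
Qed.

Section Multiplication.
Variable R : comPzRingType.
Implicit Types (P Q : polyring T R) (c d : R) (s t u : T).

Lemma monomialM c d s t :
  monomial c s * monomial d t = monomial (c * d) (s * t)%M.
Proof. exact: pol_mulUU. Qed.

Lemma coef_monomial c s t : (monomial c s)@_t = c *+ (s == t).
Proof. exact: mcoeffU. Qed.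

Lemma coef_constM c P s : (monomial c 1%M * P)@_s = c * P@_s.
Proof.
elim/pol_ind: P => [|P Q hP hQ|d t].
- by rewrite mulr0 !pol_coef0 mulr0.
- by rewrite mulrDr !pol_coefD hP hQ mulrDr.
by rewrite -[<< _ *g _ >>]/(monomial d t) monomialM !coef_monomial mul1m mulrnAr.
Qed.

Lemma coef_monomialM c u P s : left_injective (@mmul T) ->
  (monomial c u * P)@_(u * s)%M = c * P@_s.
Proof.
move=> mulI; elim/pol_ind: P => [|P Q hP hQ|d t].
- by rewrite mulr0 !pol_coef0 mulr0.
- by rewrite mulrDr !pol_coefD hP hQ mulrDr.
rewrite -[<< _ *g _ >>]/(monomial d t) monomialM !coef_monomial.
by rewrite ![(u * _)%M]mulmC (inj_eq (mulI u)) mulrnAr.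
Qed.

Lemma coef_monomialM_eq0 c u P t : ~ tdvd u t -> (monomial c u * P)@_t = 0.
Proof.
move=> ut; elim/pol_ind: P => [|P Q hP hQ|d s].
- by rewrite mulr0 pol_coef0.
- by rewrite mulrDr !pol_coefD hP hQ addr0.
rewrite -[<< _ *g _ >>]/(monomial d s) monomialM coef_monomial.
by case: eqP => // e; case: ut; exists s.
Qed.

End Multiplication.

Section CoefficientMorphism.
Variables (R S : comPzRingType) (f : {rmorphism R -> S}).

Lemma coef_map_rmorph (P : polyring T R) t : (map_coef f P)@_t = f P@_t.
Proof. by rewrite coef_map_coef // raddf0. Qed.

Lemma map_coefD (P Q : polyring T R) :
  map_coef f (P + Q) = map_coef f P + map_coef f Q.
Proof. by apply: pol_ext => t; rewrite !(pol_coefD, coef_map_rmorph) raddfD. Qed.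

Lemma map_monomial c u : map_coef f (monomial c u) = monomial (f c) u.
Proof. by apply: pol_ext => t; rewrite coef_map_rmorph !coef_monomial raddfMn. Qed.

Lemma map_coefM (P Q : polyring T R) :
  map_coef f (P * Q) = map_coef f P * map_coef f Q.
Proof.
have map0 : map_coef f 0 = 0 :> polyring T S.
  by apply: pol_ext => t; rewrite coef_map_rmorph !pol_coef0 raddf0.
elim/pol_ind: P => [|P P' hP hP'|c s].
- by rewrite mul0r map0 mul0r.
- by rewrite mulrDl !map_coefD hP hP' mulrDl.
elim/pol_ind: Q => [|Q Q' hQ hQ'|d t].
- by rewrite mulr0 map0 mulr0.
- by rewrite mulrDr !map_coefD hQ hQ' mulrDr.
rewrite -[<< _ *g _ >>]/(monomial c s) -[<< _ *g t >>]/(monomial d t).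
by rewrite monomialM !map_monomial monomialM rmorphM.
Qed.

End CoefficientMorphism.

Lemma idealB (R : comPzRingType) (K : set R) x y :
  is_ideal K -> K x -> K y -> K (x - y).
Proof. by case=> _ KD KM Kx Ky; rewrite -mulN1r; apply: KD => //; exact: KM. Qed.

(** The only point is stability under multiplication, which needs that
    coefficientwise reduction is surjective. *)
Lemma image_ideal_is_ideal (A : comPzRingType) (a : ideal A)
    (I : set (polyring T A)) : is_ideal I -> is_ideal (image_ideal I a).
Proof.
case=> I0 ID IM; split.
- exists 0 => //; apply: pol_ext => t.
  by rewrite (coef_map_rmorph (quot_map a)) !pol_coef0 raddf0.
- by move=> _ _ [P IP <-] [Q IQ <-]; exists (P + Q); [exact: ID|exact: map_coefD].
move=> Q _ [P IP <-]; pose Q' := map_coef (fun x : quot_ring a => repr x) Q.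
have QE : map_coef (quot_map a) Q' = Q.
  apply: pol_ext => t; rewrite (coef_map_rmorph (quot_map a)) /Q' /map_coef mcoeffE.
  by case: ifPn => [_|/mcoeff_outdom ->]; [exact: quot_mapK|exact: raddf0].
by exists (Q' * P); [exact: IM|rewrite (map_coefM (quot_map a)) QE].
Qed.

End Coefficients.

(** * Leading terms *)

Section LeadingTerms.
Variables (T : conomType) (ord : rel T) (ordP : term_order ord).
Variable R : comPzRingType.
Implicit Types (P Q : polyring T R) (K : set (polyring T R)) (s t : T).

(** Unlike [lterm], this excludes the zero polynomial. *)
Definition leading P t : Prop :=
  P@_t <> 0 /\ forall s, P@_s <> 0 -> ord s t.

Lemma ord_refl t : ord t t.
Proof. by case: ordP => tot *; have := tot t t; rewrite orbb. Qed.

Lemma ord_anti s t : ord s t -> ord t s -> s = t.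
Proof. by case: ordP => _ anti *; apply: anti; apply/andP. Qed.

Lemma leading_lterm P : P <> 0 -> leading P (lterm ord P).
Proof.
case: ordP => tot _ tr _ _ P0.
have supp0 : sort ord (msupp P) <> [::].
  move=> e; apply: P0; apply/eqP; rewrite -msupp_eq0; apply/eqP.
  by apply/fsetP => t; rewrite inE -(mem_sort ord) e.
split.
  apply/eqP; rewrite mcoeff_neq0 -(mem_sort ord) /lterm.
  by case: (sort _ _) supp0 => //= x l _; exact: mem_last.
move=> s /eqP; rewrite mcoeff_neq0 -(mem_sort ord) /lterm.
have := sort_sorted tot (msupp P).
elim/last_ind: (sort _ _) => // l x _; rewrite last_rcons -cats1 mem_cat inE.
rewrite (sorted_pairwise tr) pairwise_cat => /and3P[/allrelP lx _ _].
by move=> /orP[sl|/eqP ->]; [apply: lx; rewrite ?inE|exact: ord_refl].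
Qed.

Lemma leading_unique P s t : leading P s -> leading P t -> s = t.
Proof. by move=> [Ps maxs] [Pt maxt]; apply: ord_anti; auto. Qed.

Lemma leadingP P t : leading P t <-> P <> 0 /\ lterm ord P = t.
Proof.
split=> [lP|[P0 <-]]; last exact: leading_lterm.
have P0 : P <> 0 by move=> P0; case: lP; rewrite P0 pol_coef0.
by split=> //; exact: leading_unique (leading_lterm P0) lP.
Qed.

Lemma lterms_leading K t : lterms ord K t <-> exists2 P, K P & leading P t.
Proof.
split=> [[P [KP P0] <-]|[P KP /leadingP[P0 e]]]; last by exists P.
by exists P => //; exact: leading_lterm.
Qed.

Lemma lcoef_ideal_leading K t c :
  lcoef_ideal ord K t c <-> c = 0 \/ exists P, [/\ K P, leading P t & P@_t = c].
Proof.
split=> [[[P [[KP P0] <-] <-]|]|[->|[P [KP /leadingP[P0 e] <-]]]].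
- by right; exists P; split=> //; exact: leading_lterm.
- by left.
- by right.
by left; exists P; rewrite /lcoef ?e.
Qed.

Lemma not_sub_lcoef_ideal K t (q : Spec R) :
  ~ (lcoef_ideal ord K t `<=` (q : set R)) <->
  exists P, [/\ K P, leading P t & ~ ideal_set q P@_t].
Proof.
split.
  move=> /existsNP[c /not_implyP[/lcoef_ideal_leading[->|[P [KP lP <-]]] qc]].
    by case: (idealP q) qc.
  by exists P.
move=> [P [KP lP qP]] sub; apply: qP; apply: sub.
by apply/lcoef_ideal_leading; right; exists P.
Qed.

End LeadingTerms.

(** * Density of a set of primes in its closure *)

Section Primes.
Variable R : comPzRingType.

(** Zorn's lemma gives an ideal maximal among those that contain [a] and miss
    all powers of [c]; it is prime since adding to it either factor of a product
    in it yields a power of [c]. *)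
Lemma exists_prime_avoiding (a : ideal R) (c : R) :
  (forall k : nat, ~ ideal_set a (c ^+ k)) ->
  exists2 p : Spec R, ideal_set a `<=` p & ~ ideal_set p c.
Proof.
move=> ac; pose good (S : set R) := [/\ is_ideal S, ideal_set a `<=` S
  & forall k : nat, ~ S (c ^+ k)].
(* The empty set is admitted only because it is the union of the empty
   chain. *)
have [|M [[M0|[Mid aM Mc]] Mmax]] := @Zorn_bigcup R (fun S => S = set0 \/ good S).
- move=> F Fgood tot; have [F0|[S [FS S0]]] : (forall S, F S -> S = set0) \/
      exists S, F S /\ S <> set0.
    have [|/existsNP[S /not_implyP]] := pselect (forall S, F S -> S = set0).
      by left.
    by right; exists S.
  left; apply/seteqP; split=> // x [S FS]; by rewrite (F0 _ FS).
  right; have goodF X x : F X -> X x -> good X.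
    by move=> /Fgood[->|].
  have join X Z x z : F X -> F Z -> X x -> Z z ->
      exists W, [/\ F W, good W, W x & W z].
    move=> FX FZ Xx Zz; have [XZ|ZX] := tot _ _ FX FZ.
      by exists Z; split=> //; [exact: goodF Zz|exact: XZ].
    by exists X; split=> //; [exact: goodF Xx|exact: ZX].
  have [//|[Sid aS Sc]] := Fgood _ FS.
  split.
  + split.
    * by exists S => //; case: Sid.
    * move=> x y [X FX Xx] [Z FZ Zy].
      have [W [FW [[_ WD _] _ _] Wx Wy]] := join _ _ _ _ FX FZ Xx Zy.
      by exists W => //; exact: WD.
    * move=> r x [X FX Xx]; exists X => //.
      by have [[_ _ XM] _ _] := goodF _ _ FX Xx; exact: XM.
  + by move=> x ax; exists S => //; exact: aS.
  by move=> k [X FX Xc]; have [_ _ /(_ k)] := goodF _ _ FX Xc; apply.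
- exfalso; apply: (Mmax (ideal_set a)).
    rewrite M0; split=> // /(_ 0) []; by case: (idealP a).
  by right; split=> //; exact: idealP.
have big x : ~ M x -> exists (k : nat) m r, M m /\ c ^+ k = m + r * x.
  move=> Mx; apply: contrapT => nk; case: (Mid) => m0 mD mM.
  apply: (Mmax [set z | exists m r, M m /\ z = m + r * x]).
    split=> [m Mm|sub]; first by exists m, 0; rewrite mul0r addr0.
    by apply/Mx/sub; exists 0, 1; rewrite add0r mul1r.
  right; split.
  - split.
    + by exists 0, 0; rewrite mul0r addr0.
    + move=> _ _ [m [r [Mm ->]]] [m' [r' [Mm' ->]]]; exists (m + m'), (r + r').
      by split; [exact: mD|ring].
    + move=> d _ [m [r [Mm ->]]]; exists (d * m), (d * r).
      by split; [exact: mM|ring].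
  - by move=> z /aM Mz; exists z, 0; rewrite mul0r addr0.
  by move=> k [m [r [Mm ck]]]; apply: nk; exists k, m, r.
have M1 : ~ ideal_set (Ideal Mid) 1 by have := Mc 0%N; rewrite expr0.
have MM x y : ideal_set (Ideal Mid) (x * y) ->
    ideal_set (Ideal Mid) x \/ ideal_set (Ideal Mid) y.
  move=> /= Mxy; have [|Mx] := pselect (M x); first by left.
  right; apply: contrapT => My.
  have [[i [m [r [Mm ci]]]] [j [m' [r' [Mm' cj]]]]] := (big _ Mx, big _ My).
  apply: (Mc (i + j)%N); rewrite exprD ci cj.
  have -> : (m + r * x) * (m' + r' * y) =
      (m' + r' * y) * m + (r * x * m' + r * r' * (x * y)) by ring.
  by have [_ mD mM] := Mid; apply: (mD); [|apply: (mD)]; apply: mM.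
by exists (PrimeIdeal M1 MM) => //= Mc1; apply: (Mc 1%N); rewrite expr1.
Qed.

Lemma closed_vanishing (S : set R) : closed (vanishing S).
Proof. by rewrite -openC; exists S. Qed.

(** The ideal [a] is the intersection of the primes in [Y]: a prime that
    contains [a] lies in the closure of [Y], hence in every closed set
    containing [Y]. *)
Lemma closure_ideal_sub (Y : set (Spec R)) (a : ideal R) (c : R) :
  closure_ideal Y a -> (forall p, Y p -> ideal_set p c) -> ideal_set a c.
Proof.
move=> [arad Ya] Yc; apply: contrapT => ac.
have [|p ap] := @exists_prime_avoiding a c.
  by move=> k ck; apply/ac/arad; exists k.
apply; suff : vanishing [set c] p by apply.
have : closure Y p by rewrite Ya.
have /closure_id -> := @closed_vanishing [set c].
by apply: closureS => y Yy _ ->; exact: Yc.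
Qed.

End Primes.

Lemma closure_ideal_dense (A : comPzRingType) (Y : set (Spec A)) (a : ideal A)
    (c : quot_ring a) : closure_ideal Y a ->
  (forall q, Y (contract q) -> ideal_set q c) -> c = 0.
Proof.
move=> aY Yc; rewrite -[c]quot_mapK -(raddf0 (quot_map a)).
apply/quot_map_eq; rewrite subr0; apply: (closure_ideal_sub aY) => p Yp.
have : vanishing a p by rewrite -aY.2; exact: subset_closure.
rewrite -range_contract => -[q _ qp]; rewrite -qp in Yp *.
by rewrite /= /preimage /= quot_mapK; exact: Yc.
Qed.

(** * Residue fields *)

Section Residue.
Variables (R : comPzRingType) (p : Spec R).

(** The ideal that [p] generates in the local ring consists of the fractions
    with numerator in [p]. *)
Lemma to_loc_in_prime (r : R) :
  ideal_span (to_loc p @` (prime_ideal p : set R)) (to_loc p r) ->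
  ideal_set p r.
Proof.
case: (idealP p) => p0 pD pM.
move=> /(_ [set x | exists r s, [/\ ideal_set p r, ~ ideal_set p s & x = frac p r s]]).
have p1 := @prime_proper _ p.
case=> [|_ [z pz <-]|z [s [pz ps /(frac_eq _ _ p1 ps)[u pu]]]]; last 2 first.
- by exists z, 1.
- rewrite mulr1 => e; have : ideal_set p (u * (r * s)) by rewrite e; exact: pM.
  by move=> /primeP[//|/primeP[]].
split.
- by exists 0, 1.
- move=> _ _ [x [s [px ps ->]]] [y [t [py pt ->]]]; exists (x * t + y * s), (s * t).
  split; [|by case/primeP|exact: fracD].
  by rewrite mulrC [y * s]mulrC; apply: pD; exact: pM.
move=> z _ [y [t [py pt ->]]]; have [x [s [ps ->]]] := fracP z.
by exists (x * y), (s * t); split; [exact: pM|case/primeP|exact: fracM].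
Qed.

Lemma to_residue_zmod_morphism : zmod_morphism (@to_residue R p).
Proof.
have p1 := @prime_proper _ p.
move=> x y; rewrite /to_residue /loc_residue -[RHS]quot_mapB; congr quot_map.
rewrite /to_loc [X in _ = _ + X](fracN _ p1) [RHS](fracD _ _ p1 p1).
by rewrite !mulr1.
Qed.

Lemma to_residue_monoid_morphism : monoid_morphism (@to_residue R p).
Proof.
have p1 := @prime_proper _ p; split=> // x y.
rewrite /to_residue /loc_residue -[RHS](rmorphM (quot_map _)); congr quot_map.
by rewrite /to_loc [RHS](fracM _ _ p1 p1) mulr1.
Qed.

HB.instance Definition _ := GRing.isZmodMorphism.Build R (residue p)
  (@to_residue R p) to_residue_zmod_morphism.
HB.instance Definition _ := GRing.isMonoidMorphism.Build R (residue p)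
  (@to_residue R p) to_residue_monoid_morphism.

Lemma to_residue_eq0 (r : R) : to_residue p r = 0 <-> ideal_set p r.
Proof.
rewrite -(raddf0 (@to_residue R p)); split=> [/quot_map_eq|pr].
  have -> : to_loc p r - to_loc p 0 = to_loc p r.
    by rewrite (_ : to_loc p 0 = 0) ?subr0.
  exact: to_loc_in_prime.
apply/quot_map_eq; rewrite (_ : to_loc p 0 = 0) ?subr0 // => J _; apply.
by exists r.
Qed.

Lemma loc_residue_frac (r s : R) : ~ ideal_set p s ->
  to_residue p s * loc_residue (frac p r s) = to_residue p r.
Proof.
move=> ps; have p1 := @prime_proper _ p.
rewrite /to_residue /loc_residue -[LHS](rmorphM (quot_map _)); congr quot_map.
rewrite [LHS](fracM _ _ p1 ps); apply/frac_eq => //; first by case/primeP.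
by exists 1 => //; ring.
Qed.

Lemma to_residue_unit (s : R) : ~ ideal_set p s ->
  exists v, v * to_residue p s = 1.
Proof.
move=> ps; exists (loc_residue (frac p 1 s)).
by rewrite mulrC loc_residue_frac // rmorph1.
Qed.

(** The residue field is the field of fractions of [R] modulo [p]. *)
Lemma to_residue_quotient (x : residue p) :
  exists r s, ~ ideal_set p s /\ to_residue p s * x = to_residue p r.
Proof.
have [r [s [ps e]]] := fracP (repr x); exists r, s; split=> //.
by rewrite -(loc_residue_frac r ps) -e; congr (_ * _); exact: esym (quot_mapK x).
Qed.

End Residue.

(** * The singular ideal and lucky primes *)

Section SingularIdeal.
Variable R : comPzRingType.
Implicit Types (K L : set R) (q : Spec R).

Lemma ideal_mul_sub_prime K L q :
  ideal_mul K L `<=` (q : set R) <->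
  K `<=` (q : set R) \/ L `<=` (q : set R).
Proof.
case: (idealP q) => q0 qD qM; split.
  move=> sub; have [|/existsNP[x /not_implyP[Kx qx]]] := pselect (K `<=` (q : set R)).
    by left.
  right=> y Ly; case: (@primeP _ q x y) => //; apply: sub => J _; apply.
  by exists x, y.
move=> KL z; apply; first exact: idealP.
move=> _ [x [y [Kx Ly ->]]]; case: KL => sub.
  by rewrite mulrC; apply/qM/sub.
exact/qM/sub.
Qed.

(** By induction on the sequence of factors, since [ideal_mul] is not a monoid
    operation on arbitrary sets. The factors that the product over [D] leaves
    out equal [setT], which is contained in no prime. *)
Lemma big_ideal_mul_sub_prime (J : choiceType) (D : set J) (F : J -> set R) q :
  finite_set D ->
  \big[@ideal_mul R/setT]_(i \in D) F i `<=` (q : set R) <->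
  exists2 i, D i & F i `<=` (q : set R).
Proof.
move=> finD; have qT : ~ setT `<=` (q : set R).
  by move=> /(_ 1 Logic.I); exact: prime_proper.
have H (l : seq J) : \big[@ideal_mul R/setT]_(i <- l) F i `<=` (q : set R) <->
    exists2 i, i \in l & F i `<=` (q : set R).
  elim: l => [|i l IH]; first by rewrite big_nil; split=> [/qT|[]].
  rewrite big_cons ideal_mul_sub_prime IH; split.
    case=> [Fi|[j jl Fj]]; first by exists i; rewrite ?mem_head.
    by exists j => //; rewrite inE jl orbT.
  case=> j; rewrite inE => /orP[/eqP ->|jl Fj]; [by left|by right; exists j].
rewrite H; split=> -[i Di Fi]; exists i => //.
  move: Di; rewrite in_finite_support; first by move=> /set_mem[].
  by apply: sub_finite_set finD => x [].
rewrite in_finite_support; last by apply: sub_finite_set finD => x [].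
by apply/mem_set; split=> // FT; rewrite /= FT in Fi.
Qed.

Lemma radical_sub_prime K q :
  radical K `<=` (q : set R) <-> K `<=` (q : set R).
Proof.
split=> [sub x Kx|sub x [k Kk]]; first by apply: sub; exists 1%N; rewrite expr1.
have {Kk} := sub _ Kk; elim: k => [|k IH]; first by rewrite expr0 => /prime_proper.
by rewrite exprS => /primeP[].
Qed.

Variables (n : nat) (ord : rel 'X_{1..n}) (ordP : term_order ord).

Lemma leadingM (P : polyring 'X_{1..n} R) s u :
  leading ord P s -> leading ord (monomial 1 u * P) (u * s)%M.
Proof.
case: ordP => tot anti tr one mul [Ps smax].
have mulI := @term_mulIm n.
split; first by rewrite coef_monomialM // mul1r.
move=> v Pv; have [[w vE]|uv] := pselect (tdvd u v); last first.
  by case: Pv; exact: coef_monomialM_eq0.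
rewrite vE coef_monomialM // mul1r in Pv *.
by rewrite ![(u * _)%M]mulmC; apply/mul/smax.
Qed.

Variables (K : set (polyring 'X_{1..n} R)) (idK : is_ideal K).

Lemma lterms_tdvd s t : lterms ord K s -> tdvd s t -> lterms ord K t.
Proof.
move=> /(lterms_leading ordP)[P KP lP] [u ->]; apply/lterms_leading => //.
exists (monomial 1 u * P); first by case: idK => _ _; apply.
by rewrite mulmC; exact: leadingM.
Qed.

(** Multiplication by a monomial keeps leading coefficients, so [lc(K, s)] is
    contained in [lc(K, t)]. *)
Lemma lucky_tdvd (q : Spec R) s t : tdvd s t ->
  ~ (lcoef_ideal ord K s `<=` (q : set R)) ->
  ~ (lcoef_ideal ord K t `<=` (q : set R)).
Proof.
move=> [u ->] /not_sub_lcoef_ideal [] // P [KP lP qP].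
apply/not_sub_lcoef_ideal => //; exists (monomial 1 u * P).
rewrite mulmC; split; first by case: idK => _ _; apply.
  exact: leadingM.
by rewrite coef_monomialM ?mul1r //; exact: term_mulIm.
Qed.

Lemma luckyP (q : Spec R) :
  lucky ord K q <-> ~ vanishing (singular_ideal ord K) q.
Proof.
rewrite /vanishing /= radical_sub_prime.
rewrite big_ideal_mul_sub_prime; last exact: finite_minimal_terms.
split=> [lucky [t [Kt _]]|nlucky t Kt]; first exact: lucky.
have [s smin st] := minimal_divisor Kt; apply: lucky_tdvd st _ => Ks.
by apply: nlucky; exists s.
Qed.

End SingularIdeal.

(** Generators of the preimage of an ideal map to generators of the ideal. *)
Lemma noetherian_quot (A : comPzRingType) (a : ideal A) :
  noetherian A -> noetherian (quot_ring a).
Proof.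
move=> noeA; have pre (L : set (quot_ring a)) :
    is_ideal L -> is_ideal (quot_map a @^-1` L).
  case=> L0 LD LM; split=> [|x y|r x]; rewrite /preimage /=.
  - by rewrite raddf0.
  - by rewrite raddfD; exact: LD.
  by rewrite rmorphM; exact: LM.
move=> J idJ; have [s sE] := noeA _ (pre _ idJ).
exists [seq quot_map a x | x <- s]; apply/seteqP; split=> [x Jx L idL sL|x].
  have : ideal_set (ideal_gen [set` s]) (repr x) by rewrite -sE /preimage /= quot_mapK.
  move=> /(_ _ (pre _ idL)); rewrite /preimage /= quot_mapK; apply.
  by move=> y ys; apply: sL; exact: map_f.
apply=> // _ /mapP[y ys ->]; suff : (quot_map a @^-1` J) y by [].
by rewrite sE => L _; apply.
Qed.

(** * Reduction at a lucky prime *)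

Section NormalForms.
Variables (n : nat) (ord : rel 'X_{1..n}) (ordP : term_order ord).
Variables (R : comPzRingType) (K : set (polyring 'X_{1..n} R)).
Hypothesis idK : is_ideal K.
Implicit Types (P Q : polyring 'X_{1..n} R) (s t u v : 'X_{1..n}) (q : Spec R).

(** The form of all reduction steps below: with [c] and [d] the coefficients of
    [Q] and [P] at a term, this cancels the term without any division. *)
Definition combine c P d Q : polyring 'X_{1..n} R :=
  monomial c 1%M * P - monomial d 1%M * Q.

Lemma coef_combine c P d Q s : (combine c P d Q)@_s = c * P@_s - d * Q@_s.
Proof. by rewrite /combine mcoeffB !coef_constM. Qed.

Lemma ideal_combine c P d Q : K P -> K Q -> K (combine c P d Q).
Proof. by move=> KP KQ; have [_ _ KM] := idK; apply: idealB => //; apply: KM. Qed.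

Lemma combine_support c P d Q s :
  (combine c P d Q)@_s <> 0 -> P@_s <> 0 \/ Q@_s <> 0.
Proof.
rewrite coef_combine => nz; have [P0|] := pselect (P@_s = 0); last by left.
by right=> Q0; apply: nz; rewrite P0 Q0; ring.
Qed.

(** Where [P@_t] is invertible, [P / P@_t] is monic with leading term [t] and
    otherwise reduced modulo [lt(K)]. *)
Definition normal P t : Prop :=
  K P /\ forall s, P@_s <> 0 -> s = t \/ ord s t /\ ~ lterms ord K s.

(** A leading term of [P] would lie in [lt(K)] and differ from [t]. *)
Lemma normal_eq0 P t : normal P t -> P@_t = 0 -> P = 0.
Proof.
move=> [KP nP] Pt; apply: contrapT => /(leading_lterm ordP) lP.
have [e|[_]] := nP _ lP.1; first by apply: lP.1; rewrite e.
by apply; apply/lterms_leading => //; exists P.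
Qed.

Lemma normal_combine c P d Q t :
  normal P t -> normal Q t -> normal (combine c P d Q) t.
Proof.
move=> [KP nP] [KQ nQ]; split; first exact: ideal_combine.
by move=> s /combine_support[/nP|/nQ].
Qed.

(** The cross difference is normal and vanishes at [t], so it is 0. This says
    that [P / P@_t] and [Q / Q@_t] agree where both are defined. *)
Lemma normal_proportional P Q t s :
  normal P t -> normal Q t -> P@_s * Q@_t = Q@_s * P@_t.
Proof.
move=> nP nQ; have /normal_eq0 : normal (combine Q@_t P P@_t Q) t.
  exact: normal_combine.
rewrite coef_combine mulrC subrr => /(_ erefl) /(congr1 (fun S => S@_s)) /eqP.
rewrite coef_combine pol_coef0 subr_eq0 => /eqP.
by rewrite mulrC [in RHS]mulrC.
Qed.

Lemma prime_combine q c P d Q s :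
  ~ ideal_set q c -> ~ ideal_set q P@_s -> ideal_set q (d * Q@_s) ->
  ~ ideal_set q (combine c P d Q)@_s.
Proof.
move=> qc qP qQ; rewrite coef_combine => qD.
have [_ qA _] := idealP q; have := qA _ _ qD qQ.
by rewrite subrK => /primeP[].
Qed.

Section Lucky.
Variables (q : Spec R) (luckyK : lucky ord K q).

(** Cancel the largest term of [P] that is in [lt(K)] and is not [t], by an
    element of [K] whose leading coefficient is not in [q]; well-founded
    induction on a strict upper bound [u] of those terms. *)
Lemma exists_normal t :
  lterms ord K t -> exists2 P, normal P t & ~ ideal_set q P@_t.
Proof.
move=> Kt; have [P [KP [_ Pmax] qP]] := (not_sub_lcoef_ideal ordP _ _ _).1 (luckyK Kt).
suff gen u Q : K Q -> (forall s, Q@_s <> 0 -> ord s t) -> ~ ideal_set q Q@_t ->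
    (forall s, Q@_s <> 0 -> s <> t -> lterms ord K s -> ord s u /\ s <> u) ->
    exists2 P, normal P t & ~ ideal_set q P@_t.
  by apply: (gen t P) => // s /Pmax.
elim/(term_order_ind ordP): u Q {P KP Pmax qP} => u IH P KP Pmax qP bad.
(* The part of [P] that must disappear; its leading term is cancelled. *)
pose B : polyring 'X_{1..n} R :=
  [malg s in msupp P => if `[< s <> t /\ lterms ord K s >] then P@_s else 0].
have BE s : B@_s = if `[< s <> t /\ lterms ord K s >] then P@_s else 0.
  rewrite mcoeffE; case: ifPn => // /mcoeff_outdom ->.
  by case: ifP.
have [B0|/(leading_lterm ordP)] := pselect (B = 0).
  exists P => //; split=> // s Ps; have [|st] := pselect (s = t); first by left.
  right; split; first exact: Pmax.
  move=> Ks; apply: Ps; move: (BE s); rewrite B0 pol_coef0.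
  by have /asboolP -> : s <> t /\ lterms ord K s.
move: (lterm ord B) => v [Bv Bmax].
move: Bv; rewrite BE; case: asboolP => // -[vt Kv] Pv.
have [Q [KQ [_ Qmax] qQ]] := (not_sub_lcoef_ideal ordP _ _ _).1 (luckyK Kv).
have [vu nvu] := bad _ Pv vt Kv.
have [_ _ tr _ _] := ordP.
apply: (IH v vu nvu (combine Q@_v P P@_v Q)).
- exact: ideal_combine.
- move=> s /combine_support[/Pmax //|/Qmax sv].
  by apply: tr sv _; exact: Pmax.
- apply: prime_combine => //.
  have -> : Q@_t = 0.
    apply: contrapT => /Qmax tv; apply: vt; apply: (ord_anti ordP) => //.
    exact: Pmax.
  by rewrite mulr0; case: (idealP q).
move=> s cs st Ks; split; last first.
  by move=> sv; apply: cs; rewrite sv coef_combine mulrC subrr.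
case: (combine_support cs) => [Ps|/Qmax //].
by apply: Bmax; rewrite BE; have /asboolP -> : s <> t /\ lterms ord K s.
Qed.

(** The hypotheses say that [s] is the leading term of [P] modulo [q]. If the
    leading term of [P] is larger, its coefficient is in [q] and it can be
    cancelled without changing [P] modulo [q], up to a unit. *)
Lemma lucky_lterms P s : K P -> ~ ideal_set q P@_s ->
  (forall v, ~ ideal_set q P@_v -> ord v s) -> lterms ord K s.
Proof.
have [q0 qD qM] := idealP q.
have nz (Q : polyring 'X_{1..n} R) v : ~ ideal_set q Q@_v -> Q <> 0.
  by move=> qQ Q0; apply: qQ; rewrite Q0 pol_coef0.
move=> KP qP; have := leading_lterm ordP (nz _ _ qP).
move: (lterm ord P) => u; elim/(term_order_ind ordP): u P KP qP.
move=> u IH P KP qPs lP Pmax.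
have Ku : lterms ord K u by apply/lterms_leading => //; exists P.
have [<- //|us] := pselect (u = s).
have qPu : ideal_set q P@_u.
  apply: contrapT => /Pmax uls; apply: us; apply: (ord_anti ordP) uls _.
  by apply: lP.2 => Ps; apply: qPs; rewrite Ps.
have [Q [KQ lQ qQ]] := (not_sub_lcoef_ideal ordP _ _ _).1 (luckyK Ku).
have qC : ~ ideal_set q (combine Q@_u P P@_u Q)@_s.
  by apply: prime_combine => //; rewrite mulrC; exact: qM.
have lC := leading_lterm ordP (nz _ _ qC).
apply: (IH _ _ _ (combine Q@_u P P@_u Q) _ qC lC).
- by case: (combine_support lC.1); [exact: lP.2|exact: lQ.2].
- by move=> e; case: lC; rewrite e coef_combine mulrC subrr.
- exact: ideal_combine.
move=> v qv; apply: Pmax => qPv; apply: qv; rewrite coef_combine -mulrN.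
by apply: qD; [exact: qM|rewrite mulrC; exact: qM].
Qed.

End Lucky.

(** * Gluing normal polynomials *)

Section NormalSections.
Variables (U : set (Spec R)) (noeR : noetherian R).
Hypothesis luckyU : forall q, U q -> lucky ord K q.

Lemma frac0 q f : ~ ideal_set q f -> frac q 0 f = 0.
Proof.
by move=> qf; apply/frac_eq; rewrite //; [exact: prime_proper|exists 1;
  [exact: prime_proper|rewrite !mul0r]].
Qed.

(** [g] is locally [P / P@_t] with [P] normal. *)
Definition normal_section (g : polyring 'X_{1..n} (sections U)) t : Prop :=
  forall q : U, exists V : set (Spec R), [/\ open V, V (val q) &
    exists2 P, normal P t & forall q' : U, V (val q') ->
      ~ ideal_set (val q') P@_t /\
      forall s, germ g@_s q' = frac (val q') P@_s P@_t].

(** The coefficients at [t] of normal polynomials form an ideal [F], which no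
    prime of [U] contains. Each point of [U] avoids one of finitely many
    generators of [F]; the fraction attached to any of them is the germ there,
    and all germs together have finite support. *)
Lemma exists_normal_section t :
  lterms ord K t -> exists g, normal_section g t.
Proof.
move=> Kt; pose F := [set c | exists2 P, normal P t & P@_t = c].
have idF : is_ideal F.
  have [K0 KD KM] := idK; split.
  - by exists 0; rewrite ?pol_coef0 //; split=> // s; rewrite pol_coef0.
  - move=> _ _ [P nP <-] [Q nQ <-].
    exists (combine 1 P (-1) Q).
      exact: normal_combine.
    by rewrite coef_combine; ring.
  - move=> r _ [P nP <-]; exists (combine r P 0 P); first exact: normal_combine.
    by rewrite coef_combine; ring.
have [l lE] := noeR idF.
have lF f : f \in l -> F f by move=> fl; rewrite lE => L _; apply.
have /choice[N NP] f : exists P, F f -> normal P t /\ P@_t = f.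
  have [[P nP Pt]|nF] := pselect (F f); first by exists P.
  by exists 0 => /nF.
have /choice[d dP] (q : U) : exists f, f \in l /\ ~ ideal_set (val q) f.
  have [P nP qP] := exists_normal (luckyU (set_mem (valP q))) Kt.
  apply: contrapT => nf; apply: qP; have : F P@_t by exists P.
  rewrite lE; apply; first exact: idealP.
  by move=> f fl; apply: contrapT => qf; apply: nf; exists f.
have dF (q : U) : F (d q) by apply: lF; case: (dP q).
pose V (q : U) : set (Spec R) := ~` vanishing [set d q].
have VP (q : U) q' : V q q' <-> ~ ideal_set q' (d q).
  by split=> [Vq qd|qd sub]; [apply: Vq => _ ->|apply/qd/sub].
have fracE s (q q' : U) : V q (val q') ->
    frac (val q') (N (d q'))@_s (d q') = frac (val q') (N (d q))@_s (d q).
  move=> /VP qd; apply/frac_eq => //; first by case: (dP q').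
  exists 1; first exact: prime_proper.
  have [[nQ Qt] [nP Pt]] := (NP _ (dF q'), NP _ (dF q)).
  by have := normal_proportional s nQ nP; rewrite Pt Qt => ->.
have regc s : regular (fun q : U => frac (val q) (N (d q))@_s (d q)).
  move=> q; exists (V q); split; [by eexists|by apply/VP; case: (dP q)|].
  exists (N (d q))@_s, (d q) => q' Vq'; split; [exact/VP|exact: fracE].
pose D := [fset s in flatten [seq (msupp (N f) : seq _) | f <- l]]%fset.
exists [malg s in D => Section (regc s)].
move=> q; exists (V q); split; [by eexists|by apply/VP; case: (dP q)|].
have [nP Pt] := NP _ (dF q).
exists (N (d q)) => // q' Vq'; rewrite Pt; split; first exact/VP.
move=> s; rewrite mcoeffE; case: ifPn => [_|sD]; first exact: fracE.
rewrite mcoeff_outdom; first by apply/esym/frac0/VP.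
apply: contra sD => sN; rewrite !inE; apply/flatten_mapP; exists (d q) => //.
by case: (dP q).
Qed.

Lemma normal_section_ideal g t : normal_section g t -> ideal_sections U K g.
Proof.
move=> gP q; have [V [oV Vq [P [KP nP] gV]]] := gP q; exists V; split=> //.
exists P, P@_t; split=> // q' Vq'; have [qP gE] := gV _ Vq'; split=> //.
apply: pol_ext => s; rewrite !coef_map_coef; [exact: gE|exact: frac0|by []].
Qed.

End NormalSections.
End NormalForms.

(** * Fiber ideals and specialization *)

Section Fibers.
Variables (T : conomType) (A : comPzRingType).

Section FiberIdeal.
Variables (I : set (polyring T A)) (idI : is_ideal I) (p : Spec A).
Local Notation tr := (to_residue p).

(** The right-hand side is an ideal since scalars of the residue field are
    quotients of images of elements of [A], whose denominators can be moved
    into [u]. *)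
Lemma fiber_idealP (Q : polyring T (residue p)) :
  fiber_ideal I p Q <-> exists u P, [/\ ~ ideal_set p u, I P
    & monomial (tr u) 1%M * Q = map_coef tr P].
Proof.
have p1 := @prime_proper _ p; have [I0 ID IM] := idI.
have map1 : monomial (tr 1) 1%M = 1 :> polyring T _ by rewrite rmorph1.
split=> [spanQ|[u [P [pu IP uQ]]]]; last first.
  move=> J idJ IJ; have [_ _ JM] := idJ; have [v vu] := to_residue_unit pu.
  have -> : Q = monomial v 1%M * map_coef tr P.
    by rewrite -uQ mulrA monomialM vu mul1m mul1r.
  by apply/JM/IJ; exists P.
pose J := [set Q | exists u P, [/\ ~ ideal_set p u, I P
  & monomial (tr u) 1%M * Q = map_coef tr P]].
apply: (spanQ J); last first.
  by move=> _ [P IP <-]; exists 1, P; split=> //; rewrite map1 mul1r.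
have JD Q1 Q2 : J Q1 -> J Q2 -> J (Q1 + Q2).
  move=> [u [P [pu IP e]]] [v [S [pv IS f]]].
  exists (u * v), (monomial v 1%M * P + monomial u 1%M * S); split.
  - by case/primeP.
  - by apply: ID; apply: IM.
  rewrite map_coefD !map_coefM !map_monomial -e -f rmorphM.
  rewrite -{1}[1%M]mul1m -monomialM; ring.
have J0 : J 0.
  exists 1, 0; split=> //; rewrite mulr0; apply: pol_ext => t.
  by rewrite coef_map_rmorph !pol_coef0 raddf0.
split=> [//||S {spanQ}Q [u [P [pu IP e]]]]; first exact: JD.
elim/pol_ind: S => [|S S' hS hS'|c s].
- by rewrite mul0r.
- by rewrite mulrDl; exact: JD.
have [r [v [pv cE]]] := to_residue_quotient c.
exists (u * v), (monomial r s * P); split; [by case/primeP|exact: IM|].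
rewrite -[<< _ *g _ >>]/(monomial c s) map_coefM map_monomial -e rmorphM.
have -> : monomial (tr r) s = monomial (tr v * c) s by rewrite cE.
rewrite !mulrA !monomialM mul1m mulm1; congr (monomial _ _ * _); ring.
Qed.

End FiberIdeal.

Section Specialization.
Variables (a : ideal A) (U : set (Spec (quot_ring a))).

Lemma to_residue_repr (q : Spec (quot_ring a)) (r : A) :
  to_residue (contract q) (repr (quot_map a r)) = to_residue (contract q) r.
Proof.
apply/eqP; rewrite -subr_eq0 -raddfB; apply/eqP/to_residue_eq0.
change (ideal_set q (quot_map a (repr (quot_map a r) - r))).
rewrite quot_mapB quot_mapK subrr.
by case: (idealP q).
Qed.

Lemma to_residue_repr_eq0 (q : Spec (quot_ring a)) (c : quot_ring a) :
  to_residue (contract q) (repr c) = 0 <-> ideal_set q c.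
Proof. by rewrite to_residue_eq0 /= /preimage /= quot_mapK. Qed.

(** Specialization is only computed on representatives, hence the cleared
    denominator. *)
Lemma coef_specialize (q : U) (g : polyring T (sections U)) s c f :
  ~ ideal_set (val q) f -> germ g@_s q = frac (val q) c f ->
  to_residue (contract (val q)) (repr f) * (specialize q g)@_s =
    to_residue (contract (val q)) (repr c).
Proof.
move=> qf gE; have q1 := @prime_proper _ (contract (val q)).
rewrite /specialize coef_map_coef.
  have qf' : ~ ideal_set (contract (val q)) (repr f).
    by rewrite /= /preimage /= quot_mapK.
  rewrite gE -{1}[c]quot_mapK -{2}[f]quot_mapK loc_to_residueE //.
  exact: loc_residue_frac.
have := @loc_to_residueE A a (val q) 0 1 q1.
rewrite (_ : loc_residue _ = 0); last exact: (raddf0 (@to_residue _ _)).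
move=> <-; congr loc_to_residue; rewrite raddf0 rmorph1.
by [].
Qed.

Lemma coef_specialize_eq0 (q : U) (g : polyring T (sections U)) s c f :
  ~ ideal_set (val q) f -> germ g@_s q = frac (val q) c f ->
  (specialize q g)@_s = 0 <-> ideal_set (val q) c.
Proof.
move=> qf gE; have e := coef_specialize qf gE.
rewrite -to_residue_repr_eq0 -e; split=> [->|h]; first by rewrite mulr0.
have [|v vu] := @to_residue_unit _ (contract (val q)) (repr f).
  by rewrite /= /preimage /= quot_mapK.
by rewrite -[LHS]mul1r -vu -mulrA h mulr0.
Qed.

End Specialization.
End Fibers.

(** * Lucky primes make a set parametric *)

Section Parametric.
Variables (A : comPzRingType) (n : nat) (ord : rel 'X_{1..n}).
Variables (I : set (polyring 'X_{1..n} A)) (Y : set (Spec A)) (a : ideal A).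
Hypotheses (idealI : is_ideal I) (ordP : term_order ord).
Hypothesis aY : closure_ideal Y a.
Let K := image_ideal I a.
Let U : set (Spec (quot_ring a)) := @contract A a @^-1` Y.

Let idK : is_ideal K. Proof. exact: image_ideal_is_ideal. Qed.

Lemma residue1_neq0 (p : Spec A) : (1 : residue p) <> 0.
Proof.
rewrite -(rmorph1 (@to_residue A p)) => /to_residue_eq0; exact: prime_proper.
Qed.

Section NormalFibers.
Variables (g : polyring 'X_{1..n} (sections U)) (t : 'X_{1..n}).
Hypothesis gP : normal_section ord K g t.

Lemma specialize_normal_coef (q : U) : (specialize q g)@_t = 1.
Proof.
have [V [_ Vq [P nP gV]]] := gP q; have [qP gE] := gV q Vq.
have [|v vu] := @to_residue_unit _ (contract (val q)) (repr P@_t).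
  by rewrite /= /preimage /= quot_mapK.
have := coef_specialize qP (gE t); rewrite -{2}[to_residue _ _]mulr1.
by move=> /(congr1 ( *%R v)); rewrite !mulrA vu !mul1r.
Qed.

Lemma specialize_normal_supp (q : U) s :
  (specialize q g)@_s <> 0 -> s = t \/ ord s t /\ ~ lterms ord K s.
Proof.
have [V [_ Vq [P nP gV]]] := gP q; have [qP gE] := gV q Vq.
rewrite (coef_specialize_eq0 qP (gE s)) => qPs; apply: nP.2 => Ps.
by apply: qPs; rewrite Ps; case: (idealP (val q)).
Qed.

Lemma specialize_normal_leading (q : U) : leading ord (specialize q g) t.
Proof.
split; first by rewrite specialize_normal_coef; exact: residue1_neq0.
by move=> s /specialize_normal_supp[->|[]//]; exact: ord_refl.
Qed.

Lemma specialize_normal_fiber (q : U) :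
  fiber_ideal I (contract (val q)) (specialize q g).
Proof.
have [V [_ Vq [P [[P0 IP0 PE] _] gV]]] := gP q; have [qP gE] := gV q Vq.
apply/fiber_idealP => //; exists (repr P@_t), P0; split=> //.
  by rewrite /= /preimage /= quot_mapK.
apply: pol_ext => s; rewrite coef_constM coef_map_rmorph (coef_specialize qP (gE s)).
by rewrite -PE (coef_map_rmorph (quot_map a)) to_residue_repr.
Qed.

End NormalFibers.

(** Clear denominators in a member of the fiber ideal, and lift it to [K]. *)
Lemma lterms_fiber (q : Spec (quot_ring a)) s : lucky ord K q ->
  lterms ord (fiber_ideal I (contract q)) s -> lterms ord K s.
Proof.
move=> luckyq /(lterms_leading ordP)[Q /(fiber_idealP idealI)[u [P [pu IP e]]] lQ].
have QP v : Q@_v = 0 <-> ideal_set q (map_coef (quot_map a) P)@_v.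
  rewrite (coef_map_rmorph (quot_map a)).
  change (Q@_v = 0 <-> ideal_set (contract q) P@_v).
  have /(congr1 (fun S => S@_v)) := e.
  rewrite coef_constM coef_map_rmorph -to_residue_eq0 => <-.
  split=> [->|h]; first by rewrite mulr0.
  have [w wu] := to_residue_unit pu.
  by rewrite -[LHS]mul1r -wu -mulrA h mulr0.
apply: (lucky_lterms ordP idK luckyq (P := map_coef (quot_map a) P)).
- by exists P.
- by move=> /QP; apply: lQ.1.
by move=> v qv; apply: lQ.2 => Qv; apply: qv; apply/QP.
Qed.

(** One section for each minimal term of [lt(K)]. Fiberwise the leading terms
    are these minimal terms, which generate all leading terms of the fiber, and
    the remaining terms are outside [lt(K)]; hence the basis is reduced. *)
Lemma parametric_of_lucky : noetherian A ->
  (forall q, U q -> lucky ord K q) -> parametric ord I Y.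
Proof.
move=> noeA luckyU; exists a => //=; rewrite -/U -/K.
have noeR := noetherian_quot (a := a) noeA.
have /choice[g gP] t : exists g : polyring 'X_{1..n} (sections U),
    lterms ord K t -> normal_section ord K g t.
  have [/(exists_normal_section ordP idK noeR luckyU)[g gP]|nK] :=
    pselect (lterms ord K t); first by exists g.
  by exists 0 => /nK.
pose M := minimal_terms (lterms ord K).
have gM t : M t -> normal_section ord K (g t) t by case=> /gP.
exists (g @` M); split.
- exact/finite_image/finite_minimal_terms.
- by move=> _ [t Mt <-]; exact: normal_section_ideal (gM _ Mt).
- move=> q; split; [split| |].
  + exact/finite_image/finite_image/finite_minimal_terms.
  + move=> _ [_ [t Mt <-] <-]; split.
      exact: specialize_normal_fiber (gM _ Mt) q.
    by have /(leadingP ordP)[] := specialize_normal_leading (gM _ Mt) q.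
  + move=> s /(lterms_fiber (luckyU _ (set_mem (valP q)))) Ks.
    have [t Mt ts] := minimal_divisor Ks.
    exists (specialize q (g t)); first by exists (g t) => //; exists t.
    by have /(leadingP ordP)[_ ->] := specialize_normal_leading (gM _ Mt) q.
  + move=> _ [_ [t Mt <-] <-].
    have /(leadingP ordP)[_ e] := specialize_normal_leading (gM _ Mt) q.
    by rewrite /lcoef e (specialize_normal_coef (gM _ Mt)).
  move=> _ _ s [_ [t Mt <-] <-] [_ [u Mu <-] <-] ne; rewrite -mcoeff_neq0 => /eqP.
  have /(leadingP ordP)[_ ->] := specialize_normal_leading (gM _ Mu) q.
  move=> /(specialize_normal_supp (gM _ Mt)) st us.
  case: st => [st|[_ nK]]; last first.
    exact: nK (lterms_tdvd ordP idK Mu.1 us).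
  by apply: ne; rewrite (Mt.2 _ Mu.1) // -st.
move=> _ [t Mt <-] q q'.
have /(leadingP ordP)[_ ->] := specialize_normal_leading (gM _ Mt) q.
by have /(leadingP ordP)[_ ->] := specialize_normal_leading (gM _ Mt) q'.
Qed.

End Parametric.

(** * Points of a parametric set are lucky *)

Lemma closure_ideal_unique (A : comPzRingType) (Y : set (Spec A)) (a b : ideal A) :
  closure_ideal Y a -> closure_ideal Y b -> a = b.
Proof.
have sub (c d : ideal A) : closure_ideal Y c -> closure_ideal Y d ->
    ideal_set c `<=` d.
  move=> cY dY x cx; apply: (closure_ideal_sub dY) => p Yp.
  by have : vanishing c p; [rewrite -cY.2; exact: subset_closure|apply].
move=> aY bY; have : ideal_set a = ideal_set b.
  by apply/seteqP; split; exact: sub.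
case: a b {aY bY} => [a ha] [b hb] /= e; subst b.
by rewrite (Prop_irrelevance ha hb).
Qed.

(** Density is used twice: to find a point [q0] where the leading coefficient of
    a given [P] survives, and to show that, near [q], the numerator of a member
    of [G] has no term larger than the constant leading term [s]. *)
Lemma lucky_of_parametric (A : comPzRingType) (n : nat) (ord : rel 'X_{1..n})
    (I : set (polyring 'X_{1..n} A)) (Y : set (Spec A)) (a : ideal A) :
  is_ideal I -> term_order ord -> closure_ideal Y a -> parametric ord I Y ->
  forall q : Spec (quot_ring a), Y (contract q) -> lucky ord (image_ideal I a) q.
Proof.
move=> idI ordP aY [b bY]; have <- := closure_ideal_unique aY bY.
set U := @contract A a @^-1` Y => /= -[G [_ GK Ggb Gcst]] q Yq t.
have idK := image_ideal_is_ideal a idI.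
set K := image_ideal I a in GK idK *.
move=> /(lterms_leading ordP)[P KP lP].
have [q0 [Yq0 qP0]] : exists q0, Y (contract q0) /\ ~ ideal_set q0 P@_t.
  apply: contrapT => nq; apply: lP.1; apply: (closure_ideal_dense aY) => q0 Yq0.
  by apply: contrapT => qP; apply: nq; exists q0.
pose u0 : U := SigSub (mem_set (Yq0 : U q0)).
pose u : U := SigSub (mem_set (Yq : U q)).
have lGB (q' : U) g : G g -> leading ord (specialize q' g) (lterm ord (specialize q' g)).
  move=> Gg; apply: leading_lterm => //.
  have [[_ sub _] _ _] := Ggb q'.
  by have [|_ nz e] := sub (specialize q' g); [exists g|exact: nz].
have [g Gg gt] : exists2 g, G g & tdvd (lterm ord (specialize u0 g)) t.
  have [[_ _ gb] _ _] := Ggb u0.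
  suff /gb[_ [g Gg <-] gt] : lterms ord (fiber_ideal I (contract q0)) t by exists g.
  case: KP lP qP0 => P0 IP0 <- lP qP0; apply/lterms_leading => //.
  exists (map_coef (to_residue (contract q0)) P0).
    apply/fiber_idealP => //; exists 1, P0; split=> //; first exact: prime_proper.
    by rewrite rmorph1 mul1r.
  split=> [|s]; rewrite coef_map_rmorph.
    rewrite to_residue_eq0 => qP; apply: qP0.
    by rewrite (coef_map_rmorph (quot_map a)).
  rewrite to_residue_eq0 => qP; apply: lP.2.
  rewrite (coef_map_rmorph (quot_map a)) => Ps; apply: qP.
  by rewrite /= /preimage /= Ps; case: (idealP q0).
move: (lterm _ _) gt (fun q' => Gcst g Gg q' u0) => s st gs.
apply: lucky_tdvd st _ => //.
have {lGB}gl (q' : U) : leading ord (specialize q' g) s by rewrite -(gs q'); exact: lGB.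
have [V [[S VE] Vq [P' [f [KP' gV]]]]] := GK g Gg u.
have germE (q' : U) v : V (val q') ->
    ~ ideal_set (val q') f /\ germ g@_v q' = frac (val q') P'@_v f.
  move=> /gV[qf /(congr1 (fun S => S@_v))]; rewrite !coef_map_coef //.
  exact: frac0.
(* A basic open neighbourhood of [q] inside [V]. *)
have [h [Sh qh]] : exists h, S h /\ ~ ideal_set q h.
  apply: contrapT => nh; move: Vq; rewrite VE; apply => h Sh.
  by apply: contrapT => qh; apply: nh; exists h.
have SV (q' : Spec (quot_ring a)) : ~ ideal_set q' h -> V q'.
  by rewrite VE => qh' /(_ _ Sh).
have P0 (q' : U) v : V (val q') -> (specialize q' g)@_v = 0 <-> ideal_set (val q') P'@_v.
  by move=> /(germE q' v)[qf gE]; exact: coef_specialize_eq0 qf gE.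
have qP : ~ ideal_set q (h * P'@_s).
  by move=> /primeP[//|/(P0 u s (SV _ qh))]; exact: (gl u).1.
apply/not_sub_lcoef_ideal => //; exists (monomial h 1%M * P').
split; last by rewrite coef_constM.
  by case: idK => _ _; apply.
split; rewrite ?coef_constM.
  by move=> e; apply: qP; rewrite e; case: (idealP q).
move=> v; rewrite coef_constM => hP; apply: contrapT => nvs; apply: hP.
apply: (closure_ideal_dense aY) => q' Yq'.
pose u' : U := SigSub (mem_set (Yq' : U q')).
have [_ _ qM] := idealP q'.
have [qh'|qh'] := pselect (ideal_set q' h); first by rewrite mulrC; exact: qM.
apply: qM; apply/(P0 u' v (SV _ qh')); apply: contrapT => gv; apply: nvs.
exact: (gl u').2.
Qed.

Theorem theorem8 (A : comPzRingType) (n : nat) (ord : rel 'X_{1..n})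
    (I : set (polyring 'X_{1..n} A)) (Y : set (Spec A)) (a : ideal A)
    (noethA : noetherian A) (redA : reduced A) (idealI : is_ideal I)
    (ordP : term_order ord) (lcY : locally_closed Y)
    (aY : closure_ideal Y a) :
  (parametric ord I Y <->
     Y `&` (@contract A a @` vanishing (singular_ideal ord (image_ideal I a)))
       = set0)
  /\
  (parametric ord I Y <->
     forall q : Spec (quot_ring a), Y (contract q) ->
       lucky ord (image_ideal I a) q).
Proof.
have luckyE : parametric ord I Y <-> forall q : Spec (quot_ring a),
    Y (contract q) -> lucky ord (image_ideal I a) q.
  split; first exact: lucky_of_parametric.
  exact: parametric_of_lucky.
split=> //; rewrite luckyE.
have luckyK := luckyP ordP (image_ideal_is_ideal a idealI).
split=> [lucky|Y0 q Yq].
  apply/seteqP; split=> // p [Yp [q qJ qp]].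
  by apply: (luckyK q).1 qJ; apply: lucky; rewrite qp.
apply/luckyK => qJ; suff : (set0 : set (Spec A)) (contract q) by [].
by rewrite -Y0; split=> //; exists q.
Qed.
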